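(* Let $A,B$ be finite-dimensional Hilbert spaces, $\psi_{AB}$ a bipartite pure state, $\varepsilon\in(0,1)$, and $\Omega\in\{\text{1-LOCC},\text{LOCC},\text{SEP},\text{PPT}\}$. Then, for the number $n$ of copies, $$E_{\mathrm{D},\Omega}^{(1),\varepsilon}(\psi_{AB}^{\otimes n})=n\,S(\rho_A)+\sqrt{n\big(\operatorname{Tr}\rho_A(\log\rho_A)^2-S(\rho_A)^2\big)}\;\Phi^{-1}(\varepsilon)+O(\log n),$$ where $\rho_A=\operatorname{Tr}_B\psi_{AB}$ and $S(\rho)=-\operatorname{Tr}\rho\log\rho$ is the von Neumann entropy.
   Context: All Hilbert spaces are finite-dimensional; $\log$ is base $2$ and logarithms of positive semidefinite operators are taken on their supports. The $O(\log n)$ term is as $n\to\infty$ with the state and $\varepsilon$ fixed. $\Phi^{-1}$ is the inverse of the cumulative distribution function of the standard normal distribution. Operation classes (completely positive trace-preserving maps $\Pi_{AB\to A'B'}$, Alice holding $A,A'$, Bob holding $B,B'$): LOCC operations are those realizable by local operations and classical communication; 1-LOCC those using only one-way classical communication from Alice to Bob. With Choi–Jamiołkowski matrix $J_\Pi=\sum_{i,j,m,k}|i_Aj_B\rangle\langle m_Ak_B|\otimes\Pi(|i_Aj_B\rangle\langle m_Ak_B|)$, $\Pi$ is SEP if $J_\Pi$ is separable across $AA':BB'$ (a convex combination of tensor products of positive semidefinite operators), and PPT if $J_\Pi^{T_{BB'}}\ge0$, where $T_{BB'}$ is partial transpose on $BB'$. Distillable entanglement: for $k\in\mathbb N$, $k\ge1$,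 let $\Psi_k=\frac1k\sum_{i,j=0}^{k-1}|ii\rangle\langle jj|$ on $A'\otimes B'$ with $\dim A'=\dim B'=k$; $F_\Omega(\rho_{AB},k)=\max_{\Pi\in\Omega}\operatorname{Tr}\Pi_{AB\to A'B'}(\rho_{AB})\Psi_k$ (supremum if not attained); and $$E_{\mathrm{D},\Omega}^{(1),\varepsilon}(\rho_{AB})=\log\max\{k\in\mathbb N:F_\Omega(\rho_{AB},k)\ge1-\varepsilon\}.$$ For an $n$-fold tensor power the bipartition is $A^n:B^n$. *)

(* Defs.v *)
From HB Require Import structures.
From mathcomp Require Import all_boot all_order all_algebra.
From mathcomp Require Import complex.
From mathcomp Require Import all_classical all_reals all_analysis.

Set Implicit Arguments.
Unset Strict Implicit.
Unset Printing Implicit Defensive.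

Import Order.TTheory GRing.Theory Num.Theory.
Import numFieldNormedType.Exports.

Local Open Scope ring_scope.
Local Open Scope classical_set_scope.
Local Open Scope complex_scope.
Local Open Scope sesquilinear_scope.

(* A finite type I stands for the Hilbert space C^I with its orthonormal basis
   (|i>)_{i : I}.  Then I * J stands for the tensor product of C^I and C^J, and
   {ffun 'I_n -> I} for the n-fold tensor power of C^I. *)
Notation ket R I := 'cV[R[i]]_#|{: I}|.
Notation op R I := 'M[R[i]]_#|{: I}|.
Notation superop R I J := (op R I -> op R J).

Section Operators.
Variable R : realType.
Implicit Types I J : finType.

Definition entry I (X : op R I) (i j : I) : R[i] :=
  X (enum_rank i) (enum_rank j).

Definition opmx I (f : I -> I -> R[i]) : op R I :=
  \matrix_(k, l) f (enum_val k) (enum_val l).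

Definition ketbra I (i j : I) : op R I := delta_mx (enum_rank i) (enum_rank j).

Definition psd n (X : 'M[R[i]]_n) : Prop :=
  forall v : 'cV[R[i]]_n, 0 <= (v^t* *m X *m v) 0 0.

Definition tens I J (X : op R I) (Y : op R J) : op R (I * J) :=
  opmx (fun p q : I * J => entry X p.1 q.1 * entry Y p.2 q.2).

Definition ptrace2 I J (X : op R (I * J)) : op R I :=
  opmx (fun a a' => \sum_(b : J) entry X (a, b) (a', b)).

Definition ptranspose2 I J (X : op R (I * J)) : op R (I * J) :=
  opmx (fun p q : I * J => entry X (p.1, q.2) (q.1, p.2)).

(* Identification of (A (x) B) (x) (A' (x) B') with (A (x) A') (x) (B (x) B'). *)
Definition regroup (A B A' B' : finType) (X : op R ((A * B) * (A' * B')))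
    : op R ((A * A') * (B * B')) :=
  opmx (fun p q : (A * A') * (B * B') =>
    entry X ((p.1.1, p.2.1), (p.1.2, p.2.2)) ((q.1.1, q.2.1), (q.1.2, q.2.2))).

(* The n-th tensor power of an operator on A (x) B, with its tensor factors
   rearranged so that it acts on A^n (x) B^n. *)
Definition bipartite_tpow (A B : finType) (n : nat) (X : op R (A * B))
    : op R ({ffun 'I_n -> A} * {ffun 'I_n -> B}) :=
  opmx (fun p q : {ffun 'I_n -> A} * {ffun 'I_n -> B} =>
    \prod_(k < n) entry X (p.1 k, p.2 k) (q.1 k, q.2 k)).

Definition separable_op I J (X : op R (I * J)) : Prop :=
  exists (N : nat) (p : 'I_N -> R) (P : 'I_N -> op R I) (Q : 'I_N -> op R J),
    [/\ forall x, 0 <= p x, \sum_x p x = 1,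
        forall x, psd (P x) /\ psd (Q x) &
        X = \sum_x (p x)%:C *: tens (P x) (Q x)].

(* For linear f and g this is the tensor product of f and g, obtained by
   expanding the argument in the basis |i><j| (x) |k><l|. *)
Definition tens_map I J I' J' (f : superop R I I') (g : superop R J J')
    : superop R (I * J) (I' * J') :=
  fun X => \sum_(p : I * J) \sum_(q : I * J)
    entry X p q *: tens (f (ketbra p.1 q.1)) (g (ketbra p.2 q.2)).

Definition completely_positive I J (f : superop R I J) : Prop :=
  linear f /\
  forall (k : nat) (X : op R ('I_k * I)), psd X -> psd (tens_map idfun f X).

Definition channel I J (f : superop R I J) : Prop :=
  completely_positive f /\ forall X, \tr (f X) = \tr X.

Definition instrument (X I J : finType) (E : X -> superop R I J) : Prop :=
  (forall x, completely_positive (E x)) /\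
  forall rho, \sum_x \tr (E x rho) = \tr rho.

(* Alice measures with an instrument and sends the outcome x to Bob, who then
   applies a channel depending on x.  Such a map, as well as every map in LOCC
   below, is automatically a channel. *)
Definition one_way_LOCC (A B A' B' : finType)
    (L : superop R (A * B) (A' * B')) : Prop :=
  exists (X : finType) (E : X -> superop R A A') (D : X -> superop R B B'),
    [/\ instrument E, forall x, channel (D x) &
        forall rho, L rho = \sum_x tens_map (E x) (D x) rho].

(* Protocols with finitely many rounds: in each round one party applies a local
   instrument and announces its outcome x, on which the rest of the protocol
   may depend; the last step is a product of local channels.  Infinite-round
   protocols are limits of these, hence do not change any supremum over LOCC. *)
Inductive LOCC (A' B' : finType) :
    forall A B : finType, superop R (A * B) (A' * B') -> Prop :=
| LOCC_local (A B : finType) (f : superop R A A') (g : superop R B B')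
    (L : superop R (A * B) (A' * B')) :
    channel f -> channel g ->
    (forall rho, L rho = tens_map f g rho) ->
    LOCC L
| LOCC_alice (A B A1 X : finType) (E : X -> superop R A A1)
    (K : X -> superop R (A1 * B) (A' * B')) (L : superop R (A * B) (A' * B')) :
    instrument E -> (forall x, LOCC (K x)) ->
    (forall rho, L rho = \sum_x K x (tens_map (E x) idfun rho)) ->
    LOCC L
| LOCC_bob (A B B1 X : finType) (E : X -> superop R B B1)
    (K : X -> superop R (A * B1) (A' * B')) (L : superop R (A * B) (A' * B')) :
    instrument E -> (forall x, LOCC (K x)) ->
    (forall rho, L rho = \sum_x K x (tens_map idfun (E x) rho)) ->
    LOCC L.

Definition choi (I J : finType) (L : superop R I J) : op R (I * J) :=
  \sum_(p : I) \sum_(q : I) tens (ketbra p q) (L (ketbra p q)).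

Definition SEP_map (A B A' B' : finType)
    (L : superop R (A * B) (A' * B')) : Prop :=
  channel L /\ separable_op (regroup (choi L)).

Definition PPT_map (A B A' B' : finType)
    (L : superop R (A * B) (A' * B')) : Prop :=
  channel L /\ psd (ptranspose2 (regroup (choi L))).

End Operators.

Inductive op_class := OneLOCC | AllLOCC | SEP | PPT.

Definition in_class (R : realType) (Omega : op_class) (A B A' B' : finType)
    (L : superop R (A * B) (A' * B')) : Prop :=
  match Omega with
  | OneLOCC => one_way_LOCC L
  | AllLOCC => LOCC L
  | SEP => SEP_map L
  | PPT => PPT_map L
  end.

Section Quantities.
Variable R : realType.

Definition log2 (x : R) : R := ln x / ln 2.

(* Logarithm of a positive semidefinite operator through its spectral
   decomposition; as ln 0 = 0, it is taken on the support. *)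
Definition logm n (X : 'M[R[i]]_n) : 'M[R[i]]_n :=
  invmx (spectralmx X)
    *m diag_mx (map_mx (fun z => (log2 (complex.Re z))%:C) (spectral_diag X))
    *m spectralmx X.

Definition entropy n (rho : 'M[R[i]]_n) : R :=
  - complex.Re (\tr (rho *m logm rho)).

Definition entropy_variance n (rho : 'M[R[i]]_n) : R :=
  complex.Re (\tr (rho *m (logm rho *m logm rho))) - entropy rho ^+ 2.

Definition max_entangled (k : nat) : op R ('I_k * 'I_k) :=
  (k%:R)^-1 *: \sum_(i < k) \sum_(j < k) ketbra R (i, i) (j, j).

Definition fidelity (Omega : op_class) (A B : finType) (rho : op R (A * B))
    (k : nat) : R :=
  sup [set complex.Re (\tr (L rho *m max_entangled k))
      | L in @in_class R Omega A B 'I_k 'I_k].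

(* The maximum of S, and 0 if S has none. *)
Definition max_nat (S : set nat) : nat :=
  xget 0%N [set k | S k /\ forall j, S j -> (j <= k)%N].

Definition distillable_entanglement (Omega : op_class) (eps : R)
    (A B : finType) (rho : op R (A * B)) : R :=
  log2 (max_nat [set k | (1 <= k)%N /\ 1 - eps <= fidelity Omega rho k])%:R.

Definition Phi (x : R) : R := fine (normal_prob 0 1 `]-oo, x]).

(* Phi is a bijection from R to ]0, 1[; the value outside ]0, 1[ is junk. *)
Definition Phi_inv (p : R) : R := xget 0 [set x | Phi x = p].

End Quantities.

(* Main.v *)
(* Write psi^(x)n in Schmidt form with squared coefficients p_i, a product
   distribution whose logarithm is a sum of n independent copies of log p.

   Converse: every operation L in one of the four classes is positive, trace
   preserving, and remains positive when conjugated by the partial transpose.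
   Splitting the Schmidt vectors at a threshold t, the part with p_i < t has
   fidelity at most its weight, and the part with p_i >= t at most 1/(kt),
   because the partial transpose of the maximally entangled state is SWAP/k.
   Hence up to O(1/sqrt n) the fidelity is P(p_i < t) unless kt < n.

   Achievability: i |-> p_i takes at most (n+1)^|A| values (types).  Cut every
   type class into blocks of size k.  Alice measures the block and announces
   it; a full block carries a perfect maximally entangled state, so the loss is
   at most P(p_i > t) + (n+1)^|A| k t.

   Both bounds give log k = - log t + O(log n), and t is chosen by the
   Berry-Esseen theorem, which is proved by Stein's method. *)

(* The tolerance O(log n) decides which estimates may be crude. A factor polynomial in n in the
   product kt changes log k by O(log n) only. Probabilities, in contrast, must be right up to
   O(1/sqrt n): the quantile gets multiplied by sqrt(nV), with V the variance, so a central limit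
   theorem without a rate would not do. Stein's method gives this rate with nothing but finite sums
   over the law of the copies and one explicit real function.

   The same demand shapes the converse. Cutting the Schmidt vectors at t leaves cross terms between
   the two parts. Positivity bounds them at the price of factors 1 + c and 1 + 1/c on the two
   weights; c = 1/sqrt n keeps the first loss at O(1/sqrt n), and the second, about sqrt n / (kt),
   is as small once kt reaches n. This is why the threshold for kt is n and not a constant.

   If V = 0 (flat Schmidt spectrum) nothing can be normalised, but the sum of logarithms is then
   constant on the support and its distribution function is a single step. *)
Require Import Defs.
From HB Require Import structures.
From mathcomp Require Import all_boot all_order all_algebra.
From mathcomp Require Import complex.
From mathcomp Require Import all_classical all_reals all_analysis.
From mathcomp Require Import ring lra.
Import Order.TTheory GRing.Theory Num.Theory.
Import numFieldNormedType.Exports.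

Set Implicit Arguments.
Unset Strict Implicit.
Unset Printing Implicit Defensive.

Local Open Scope ring_scope.
Local Open Scope classical_set_scope.
Local Open Scope sesquilinear_scope.

(** * The Stein equation for the normal distribution *)

Section Gauss.
Variable R : realType.
Local Notation Phi := (@Phi R).

(** Limits of distribution functions are stated for random variables; [Phi] is the distribution
    function of the identity under the normal law. *)
Let idTR : measurableTypeR R -> R := idfun.

#[local] HB.instance Definition _ :=
  @isMeasurableFun.Build _ _ _ _ idTR (@measurable_id _ _ setT).

Definition phi (x : R) : R := normal_pdf 0 1 x.

Lemma phiE x : phi x = @normal_peak R 1 * expR (- (x ^+ 2 / 2)).
Proof.
rewrite /phi normal_pdfE ?oner_neq0// /normal_fun subr0 expr1n.
by rewrite mulNr.
Qed.

Lemma phi_gt0 x : 0 < phi x.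
Proof. by rewrite phiE mulr_gt0 ?expR_gt0// normal_peak_gt0// oner_neq0. Qed.

Lemma is_derive_Phi (x : R) : is_derive x 1 Phi (phi x).
Proof.
have /= := @continuous_FTC1 R phi (BInfty _ true) x (x + 1).
case.
- by rewrite ltrDl.
- apply: (@integrableS _ _ _ _ setT) => //.
  exact: integrable_normal_pdf.
- exact: ltNyr.
- by apply: continuous_normal_pdf; exact: oner_neq0.
move=> d1 d2; apply: DeriveDef; first exact: d1.
by rewrite -derive1E; exact: d2.
Qed.

Lemma Phi_ge0 x : 0 <= Phi x.
Proof. by rewrite /Defs.Phi fine_ge0. Qed.

Lemma cvg_Phi_pinfty : Phi x @[x --> +oo] --> (1 : R).
Proof. exact: (fine_cvg (@cvg_cdfy1 _ _ _ (normal_prob (0:R) 1) (idTR : {RV (normal_prob (0:R) 1) >-> R}))). Qed.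


Lemma cvg_Phi_ninfty : Phi x @[x --> -oo] --> (0 : R).
Proof. exact: (fine_cvg (@cvg_cdfNy0 _ _ _ (normal_prob (0:R) 1) (idTR : {RV (normal_prob (0:R) 1) >-> R}))). Qed.

Lemma MVT_is_derive (f df : R -> R) (a b : R) :
  (forall x : R, is_derive x 1 f (df x)) -> a < b ->
  exists2 c, a < c < b & f b - f a = df c * (b - a).
Proof.
move=> fdf ab.
have cf : {within `[a, b], continuous f}.
  apply: derivable_within_continuous => x _; exact: (@ex_derive _ _ _ _ _ _ _ (fdf x)).
have [c] := MVT ab (fun x _ => fdf x) cf.
by rewrite in_itv/= => ? ?; exists c.
Qed.

Lemma is_derive_ge0_le (f df : R -> R) (a b : R) :
  (forall x : R, is_derive x 1 f (df x)) -> (forall x, a < x < b -> 0 <= df x) ->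
  a <= b -> f a <= f b.
Proof.
move=> fdf df0; rewrite le_eqVlt => /predU1P[->//|ab].
have [c cab e] := MVT_is_derive fdf ab.
by rewrite -subr_ge0 e mulr_ge0 ?df0// subr_ge0 ltW.
Qed.

Lemma Phi_le (a b : R) : a <= b -> Phi a <= Phi b.
Proof.
apply: is_derive_ge0_le; first exact: is_derive_Phi.
by move=> x _; rewrite ltW// phi_gt0.
Qed.

Lemma Phi_le1 (x : R) : Phi x <= 1.
Proof.
have -> : 1 = lim (Phi y @[y --> +oo]).
  by apply/esym/cvg_lim => //; exact: cvg_Phi_pinfty.
apply: limr_ge; first by apply/cvg_ex; exists 1; exact: cvg_Phi_pinfty.
near=> y; apply: Phi_le; near: y; apply: nbhs_pinfty_ge; exact: num_real.
Unshelve. all: by end_near. Qed.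

Lemma is_deriveM1 (f g : R -> R) (x df dg : R) :
  is_derive x 1 f df -> is_derive x 1 g dg ->
  is_derive x 1 (fun y => f y * g y) (df * g x + f x * dg).
Proof.
move=> hf hg; apply: (is_derive_eq (is_deriveM hf hg)).
by rewrite /GRing.scale/= addrC [X in _ = X + _]mulrC.
Qed.

Lemma is_derive_affine (a b x : R) : is_derive x 1 (fun y => a * y + b) a.
Proof.
have -> : (fun y => a * y + b) = (a \*: (id : R -> R)) + cst b by [].
apply: is_derive_eq.
by rewrite addr0 /GRing.scale/= mulr1.
Qed.

Lemma is_derive_gauss (k c x : R) :
  is_derive x 1 (fun y => k * expR (y * (c * y + 0)))
    (2 * c * x * (k * expR (x * (c * x + 0)))).
Proof.
have h1 : is_derive x 1 (fun y => y * (c * y + 0)) (2 * c * x).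
  have hid : is_derive x 1 (fun y : R => y) 1 by exact: is_derive_id.
  apply: (is_derive_eq (is_deriveM1 hid (is_derive_affine c 0 x))).
  by ring.
have h2 := is_derive1_comp (is_derive_expR _) h1.
have hc : is_derive x 1 (fun _ : R => k) 0 by exact: is_derive_cst.
by apply: (is_derive_eq (is_deriveM1 hc h2)); ring.
Qed.

Lemma is_derive_invphi (x : R) :
  is_derive x 1 (fun y => (phi y)^-1) (x * (phi x)^-1).
Proof.
have e y : (phi y)^-1 = (@normal_peak R 1)^-1 * expR (y * (2^-1 * y + 0)).
  by rewrite phiE invfM expRN (invrK (expR _)); congr (_ * expR _); field.
rewrite (funext e) e.
by apply: (is_derive_eq (is_derive_gauss (@normal_peak R 1)^-1 2^-1 x)); congr (_ * _); field.
Qed.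

Lemma is_derive_phi (x : R) : is_derive x 1 phi (- (x * phi x)).
Proof.
have e y : phi y = @normal_peak R 1 * expR (y * (- 2^-1 * y + 0)).
  by rewrite phiE; congr (_ * expR _); field.
rewrite (funext e : phi = _).
by apply: (is_derive_eq (is_derive_gauss (@normal_peak R 1) (- 2^-1) x)); rewrite -mulNr; congr (_ * _); field.
Qed.

Lemma is_deriveD1 (f g : R -> R) (x df dg : R) :
  is_derive x 1 f df -> is_derive x 1 g dg ->
  is_derive x 1 (fun y => f y + g y) (df + dg).
Proof. by move=> hf hg; exact: is_deriveD. Qed.

Lemma is_deriveZ1 (f : R -> R) (a x df : R) :
  is_derive x 1 f df -> is_derive x 1 (fun y => a * f y) (a * df).
Proof. by move=> hf; exact: is_deriveZ. Qed.

(** Mills ratios: [stein_lo] solves f' = w f + 1 and stays bounded towards -oo, [stein_hi] solves f'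
    = w f - 1 and stays bounded towards +oo. Multiples of them are glued at [z] below. *)
Definition stein_lo (w : R) : R := Phi w * (phi w)^-1.
Definition stein_hi (w : R) : R := (-1 * Phi w + 1) * (phi w)^-1.

Lemma is_derive_stein_lo (w : R) :
  is_derive w 1 stein_lo (1 + w * stein_lo w).
Proof.
apply: (is_derive_eq (is_deriveM1 (is_derive_Phi w) (is_derive_invphi w))).
by rewrite divff ?gt_eqF ?phi_gt0// /stein_lo; ring.
Qed.

Lemma is_derive_stein_hi (w : R) :
  is_derive w 1 stein_hi (w * stein_hi w - 1).
Proof.
apply: (is_derive_eq (is_deriveM1
  (is_derive1_comp (is_derive_affine (-1) 1 (Phi w)) (is_derive_Phi w))
  (is_derive_invphi w))).
by rewrite /= mulN1r mulNr divff ?gt_eqF ?phi_gt0// /stein_hi; ring.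
Qed.

(** With [w] frozen in the coefficient, y |-> Phi y + phi y / w has derivative phi y (1 - y / w) and
    so decreases on y >= w, while it stays above Phi y, which tends to 1. *)
Lemma mills_hi (w : R) : 0 < w -> w * stein_hi w <= 1.
Proof.
move=> w0; have p0 := phi_gt0 w.
suff h : 1 <= Phi w + w^-1 * phi w.
  rewrite /stein_hi mulrA ler_pdivrMr// mul1r mulrC -ler_pdivlMr//.
  by rewrite mulrC; lra.
have -> : 1 = lim (Phi y @[y --> +oo]).
  by apply/esym/cvg_lim => //; exact: cvg_Phi_pinfty.
apply: limr_le; first by apply/cvg_ex; exists 1; exact: cvg_Phi_pinfty.
near=> y.
have wy : w <= y by near: y; apply: nbhs_pinfty_ge; exact: num_real.
apply: (@le_trans _ _ (Phi y + w^-1 * phi y)).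
  by rewrite lerDl mulr_ge0// ?invr_ge0 ltW// phi_gt0.
rewrite -lerN2.
have h (x : R) : is_derive x 1 (fun x => -1 * (Phi x + w^-1 * phi x))
    (-1 * (phi x + w^-1 * (- (x * phi x)))).
  by apply: is_deriveZ1; apply: is_deriveD1; [exact: is_derive_Phi|apply: is_deriveZ1; exact: is_derive_phi].
have := @is_derive_ge0_le _ _ w y h; rewrite !mulN1r; apply => // x /andP[wx _].
rewrite (_ : -1 * _ = phi x * (w^-1 * x - 1)); last by ring.
by rewrite mulr_ge0 ?(ltW (phi_gt0 _))// subr_ge0 mulrC ler_pdivlMr// mul1r ltW.
Unshelve. all: by end_near. Qed.

Lemma mills_lo (w : R) : w < 0 -> - w * stein_lo w <= 1.
Proof.
move=> w0; have p0 := phi_gt0 w.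
suff h : Phi w + w^-1 * phi w <= 0.
  rewrite /stein_lo mulrA ler_pdivrMr// mul1r.
  have wn : 0 <= - w by lra.
  have e : - w * (Phi w + w^-1 * phi w) = - w * Phi w - phi w.
    by field; rewrite lt_eqF.
  by have := ler_wpM2l wn h; rewrite mulr0 e; lra.
have -> : 0 = lim (Phi y @[y --> -oo]).
  by apply/esym/cvg_lim => //; exact: cvg_Phi_ninfty.
apply: limr_ge; first by apply/cvg_ex; exists 0; exact: cvg_Phi_ninfty.
near=> y.
have wy : y <= w by near: y; apply: nbhs_ninfty_le; exact: num_real.
apply: (@le_trans _ _ (Phi y + w^-1 * phi y)); last first.
  by rewrite gerDl mulr_le0_ge0// ?invr_le0 ltW// phi_gt0.
rewrite -lerN2.
have h (x : R) : is_derive x 1 (fun x => -1 * (Phi x + w^-1 * phi x))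
    (-1 * (phi x + w^-1 * (- (x * phi x)))).
  by apply: is_deriveZ1; apply: is_deriveD1; [exact: is_derive_Phi|apply: is_deriveZ1; exact: is_derive_phi].
have := @is_derive_ge0_le _ _ y w h; rewrite !mulN1r; apply => // x /andP[_ xw].
rewrite (_ : -1 * _ = phi x * (w^-1 * x - 1)); last by ring.
rewrite mulr_ge0 ?(ltW (phi_gt0 _))// subr_ge0 mulrC ler_ndivlMr// mul1r ltW//.
Unshelve. all: by end_near. Qed.

Lemma phiN (w : R) : phi (- w) = phi w.
Proof. by rewrite !phiE sqrrN. Qed.

Lemma invphi_le (w : R) : -1 <= w <= 1 -> (phi w)^-1 <= (phi 1)^-1.
Proof.
have h v : 0 <= v <= 1 -> (phi v)^-1 <= (phi 1)^-1.
  move=> /andP[v0 v1].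
  apply: (is_derive_ge0_le is_derive_invphi _ v1) => x /andP[vx _].
  by rewrite mulr_ge0 ?invr_ge0 ?(ltW (phi_gt0 _))//; lra.
move=> /andP[w1 w2]; case: (leP 0 w) => w0; first by apply: h; rewrite w0.
by rewrite -phiN; apply: h; lra.
Qed.

(** The summand 1 bounds the Mills ratios where |w| >= 1, through the [mills] lemmas; [(phi 1)^-1]
    bounds them where |w| <= 1. *)
Definition stein_cst : R := 1 + (phi 1)^-1.

Lemma stein_cst_ge1 : 1 <= stein_cst.
Proof. by rewrite lerDl invr_ge0 ltW// phi_gt0. Qed.

Lemma stein_lo_ge0 (w : R) : 0 <= stein_lo w.
Proof. by rewrite mulr_ge0 ?Phi_ge0// invr_ge0 ltW ?phi_gt0. Qed.

Lemma stein_hi_ge0 (w : R) : 0 <= stein_hi w.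
Proof.
by rewrite mulr_ge0 ?invr_ge0 ?(ltW (phi_gt0 _))//; have := Phi_le1 w; lra.
Qed.

Lemma stein_hi_le (w : R) : 0 <= w -> stein_hi w <= stein_cst.
Proof.
move=> w0; have c1 := stein_cst_ge1; have h0 := stein_hi_ge0 w.
case: (leP w 1) => w1; last first.
  have := mills_hi (lt_trans ltr01 w1).
  have : 0 <= (w - 1) * stein_hi w by rewrite mulr_ge0//; lra.
  by rewrite mulrBl mul1r; lra.
have w11 : -1 <= w <= 1 by lra.
rewrite /stein_cst; have := invphi_le w11.
suff : stein_hi w <= (phi w)^-1 by lra.
rewrite ler_piMl ?invr_ge0 ?(ltW (phi_gt0 _))//.
by have := Phi_ge0 w; lra.
Qed.

Lemma stein_lo_le (w : R) : w <= 0 -> stein_lo w <= stein_cst.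
Proof.
move=> w0; have c1 := stein_cst_ge1; have h0 := stein_lo_ge0 w.
case: (leP (-1) w) => w1; last first.
  have wn : w < 0 by lra.
  have := mills_lo wn.
  have : 0 <= (- w - 1) * stein_lo w by rewrite mulr_ge0//; lra.
  by rewrite mulrBl mul1r; lra.
have w11 : -1 <= w <= 1 by lra.
rewrite /stein_cst; have := invphi_le w11.
suff : stein_lo w <= (phi w)^-1 by lra.
by rewrite ler_piMl ?invr_ge0 ?(ltW (phi_gt0 _))// Phi_le1.
Qed.

(* The bounded solution of Stein's equation f'(w) = w f(w) + 1_(w <= z) - Phi z;
   [dstein] is its derivative, with the left derivative at the kink w = z. *)
Definition stein (z w : R) : R :=
  if w <= z then stein_lo w * (1 - Phi z) else stein_hi w * Phi z.

Definition dstein (z w : R) : R := w * stein z w + (w <= z)%R%:R - Phi z.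

(** Since 1 - Phi z <= 1 - Phi w, and stein_lo w (1 - Phi w) = stein_hi w Phi w. Thus for w >= 0
    both branches of [stein] are controlled by [stein_hi], the ratio that is bounded there. *)
Lemma stein_lo_hi (z w : R) : w <= z ->
  stein_lo w * (1 - Phi z) <= stein_hi w * Phi w.
Proof.
move=> wz; rewrite /stein_lo /stein_hi.
rewrite [leLHS]mulrAC [leRHS]mulrAC ler_wpM2r ?invr_ge0 ?(ltW (phi_gt0 _))//.
rewrite mulrC ler_wpM2r ?Phi_ge0//.
by have := Phi_le wz; lra.
Qed.

Lemma stein_bounds (z w : R) :
  0 <= stein z w <= stein_cst /\ `|w * stein z w| <= 1.
Proof.
have p0 := Phi_ge0 z; have p1 := Phi_le1 z; have q0 := Phi_ge0 w; have q1 := Phi_le1 w.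
have l0 := stein_lo_ge0 w; have h0 := stein_hi_ge0 w.
have f0 : 0 <= stein z w.
  by rewrite /stein; case: ifP => _; rewrite mulr_ge0//; lra.
case: (leP 0 w) => w0.
  have fh : stein z w <= stein_hi w.
    rewrite /stein; case: ifP => wz; last by rewrite ler_piMr.
    by apply: (le_trans (stein_lo_hi wz)); rewrite ler_piMr.
  split; first by rewrite f0 (le_trans fh)// stein_hi_le.
  rewrite ger0_norm ?mulr_ge0//.
  move: w0; rewrite le_eqVlt => /predU1P[<-|w0]; first by rewrite mul0r ler01.
  by apply: le_trans (mills_hi w0); rewrite ler_wpM2l// ltW.
have fl : stein z w <= stein_lo w.
  rewrite /stein; case: ifPn => [_|]; first by rewrite ler_piMr//; lra.
  rewrite -ltNge => /ltW/Phi_le zw.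
  rewrite /stein_hi /stein_lo mulrAC ler_wpM2r ?invr_ge0 ?(ltW (phi_gt0 _))//.
  apply: le_trans zw; rewrite ler_piMl//; lra.
split; first by rewrite f0 (le_trans fl)// stein_lo_le// ltW.
rewrite ler0_norm ?mulr_le0_ge0 ?(ltW w0)// -mulNr.
by apply: le_trans (mills_lo w0); rewrite ler_wpM2l// oppr_ge0 ltW.
Qed.

Lemma dstein_bound (z w : R) : `|dstein z w| <= 2.
Proof.
have [_] := stein_bounds z w; have [p0 p1] := conj (Phi_ge0 z) (Phi_le1 z).
rewrite /dstein !ler_norml => /andP[h1 h2].
by case: (w <= z) => /=; lra.
Qed.

(** For a < b: one branch of [stein] is in force on all of [a, b]. The asymmetry follows the
    convention that the kink itself belongs to the left branch. *)
Definition same_side (z a b : R) := (b <= z) || (z < a).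

Lemma stein_mvt (z a b : R) : a < b -> same_side z a b ->
  exists2 c, a < c < b & stein z b - stein z a = dstein z c * (b - a).
Proof.
move=> ab /orP[bz|za].
  have az : a <= z by rewrite (le_trans (ltW ab)).
  have h (x : R) : is_derive x 1 (fun y => (1 - Phi z) * stein_lo y)
      ((1 - Phi z) * (1 + x * stein_lo x)).
    by apply: is_deriveZ1; exact: is_derive_stein_lo.
  have [c /andP[ac cb] e] := MVT_is_derive h ab.
  exists c; first by rewrite ac.
  have cz : c <= z by rewrite (le_trans (ltW cb)).
  by rewrite /dstein /stein az bz cz -!(mulrC (1 - Phi z)) e/=; ring.
have zb : z < b by rewrite (lt_trans za).
have h (x : R) : is_derive x 1 (fun y => Phi z * stein_hi y)
    (Phi z * (x * stein_hi x - 1)).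
  by apply: is_deriveZ1; exact: is_derive_stein_hi.
have [c /andP[ac cb] e] := MVT_is_derive h ab.
exists c; first by rewrite ac.
have zc : z < c by rewrite (lt_trans za).
rewrite /dstein /stein !leNgt za zb zc/= -!(mulrC (Phi z)) e; ring.
Qed.

Lemma stein_lip_le (z a b : R) : a <= b ->
  `|stein z b - stein z a| <= 2 * (b - a).
Proof.
rewrite le_eqVlt => /predU1P[->|ab]; first by rewrite !subrr normr0 mulr0.
have H (x y : R) : x < y -> same_side z x y -> `|stein z y - stein z x| <= 2 * (y - x).
  move=> xy ss; have [c _ ->] := stein_mvt xy ss.
  rewrite normrM (gtr0_norm (_ : 0 < y - x)) ?subr_gt0//.
  by rewrite ler_wpM2r ?dstein_bound// subr_ge0 ltW.
have [ss|] := boolP (same_side z a b); first exact: H.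
rewrite negb_or -ltNge -leNgt => /andP[zb az].
have h1 : `|stein z z - stein z a| <= 2 * (z - a).
  move: az; rewrite le_eqVlt => /predU1P[->|az]; first by rewrite !subrr normr0 mulr0.
  by apply: H => //; rewrite /same_side lexx.
(* [same_side z z b] fails, as [z] belongs to the left branch. The two branches agree at [z] ([ez]),
   so the mean value theorem is applied to the right branch extended to [z]. *)
have h2 : `|stein z b - stein z z| <= 2 * (b - z).
  have e y : z < y -> stein z y = stein_hi y * Phi z.
    by move=> zy; rewrite /stein leNgt zy.
  have ez : stein z z = stein_hi z * Phi z.
    by rewrite /stein lexx /stein_lo /stein_hi; ring.
  have h (x : R) : is_derive x 1 (fun y => Phi z * stein_hi y)
      (Phi z * (x * stein_hi x - 1)).
    by apply: is_deriveZ1; exact: is_derive_stein_hi.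
  have [c /andP[zc cb] ee] := MVT_is_derive h zb.
  rewrite e// ez -!(mulrC (Phi z)) ee normrM (gtr0_norm (_ : 0 < b - z)) ?subr_gt0//.
  rewrite ler_wpM2r ?subr_ge0 ?(ltW zb)//.
  apply: le_trans (dstein_bound z c); rewrite le_eqVlt; apply/orP; left; apply/eqP.
  by congr `|_|; rewrite /dstein /stein leNgt zc /=; ring.
have := ler_normD (stein z b - stein z z) (stein z z - stein z a).
by rewrite addrA subrK; lra.
Qed.

Lemma stein_lip (z w t : R) : `|stein z (w + t) - stein z w| <= 2 * `|t|.
Proof.
case: (leP 0 t) => t0.
  have h : w <= w + t by lra.
  by have := stein_lip_le z h; rewrite (ger0_norm t0) [w + t]addrC addrK addrC.
have h : w + t <= w by lra.
by have := stein_lip_le z h; rewrite (ltr0_norm t0) distrC opprD addrA subrr add0r.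
Qed.

(** A step shorter than the distance to the kink cannot cross it; [min] and [max] order the
    endpoints for either sign of [t]. *)
Lemma near_dist (z w t : R) : ~~ (`|w - z| <= `|t|) ->
  (w + t <= z) = (w <= z) /\
  same_side z (Num.min w (w + t)) (Num.max w (w + t)).
Proof.
rewrite -ltNge /same_side ltr_normr => /orP h.
have := ler_norm t; have := ler_norm (- t); rewrite normrN => t1 t2.
case: (leP w z) => wz.
  have {}h : `|t| < z - w.
    by case: h; lra.
  split; first by apply/idP; lra.
  by rewrite ge_max wz/=; apply/orP; left; lra.
have {}h : `|t| < w - z by case: h; lra.
split; first by apply/idP/negP; lra.
by rewrite lt_min wz/=; apply/orP; right; lra.
Qed.

(** Stein's equation trades a second derivative for values: the difference of [dstein] consists of
    differences and values of [stein], plus a jump of the indicator that occurs only near the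
    kink. *)
Lemma dstein_diff (z w t : R) :
  `|dstein z (w + t) - dstein z w| <=
  `|t| * (2 * `|w| + stein_cst) + (`|w - z| <= `|t|)%R%:R.
Proof.
have -> : dstein z (w + t) - dstein z w =
    w * (stein z (w + t) - stein z w) + t * stein z (w + t) +
    ((w + t <= z)%R%:R - (w <= z)%R%:R) by rewrite /dstein; ring.
apply: (le_trans (ler_normD _ _)); apply: lerD.
  apply: (le_trans (ler_normD _ _)); rewrite [leRHS]mulrDr; apply: lerD.
    rewrite normrM mulrA mulrC ler_wpM2r// [`|t| * 2]mulrC; exact: stein_lip.
  rewrite normrM ler_wpM2l//; have [/andP[s0 s1] _] := stein_bounds z (w + t).
  by rewrite ger0_norm.
have [h|/near_dist[-> _]] := boolP (`|w - z| <= `|t|); last by rewrite subrr normr0.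
by case: (w + t <= z); case: (w <= z); rewrite ?subrr ?subr0 ?sub0r ?normrN ?normr0 ?normr1 ?ler01.
Qed.

(** Near the kink the two Lipschitz bounds 2|t| are simply added. Away from it the difference is t
    [dstein z (w + c)] with |c| <= |t|, and [dstein_diff] applies without its jump. *)
Lemma stein_taylor (z w t : R) :
  `|stein z (w + t) - stein z w - t * dstein z w| <=
  t ^+ 2 * (2 * `|w| + stein_cst) + 4 * `|t| * (`|w - z| <= `|t|)%R%:R.
Proof.
have c1 := stein_cst_ge1.
have [h|hn] := boolP (`|w - z| <= `|t|).
  apply: (le_trans (ler_normB _ _)); rewrite mulr1.
  rewrite normrM; have := stein_lip z w t.
  have : `|t| * `|dstein z w| <= `|t| * 2 by rewrite ler_wpM2l// dstein_bound.
  have : 0 <= t ^+ 2 * (2 * `|w| + stein_cst).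
    by rewrite mulr_ge0 ?sqr_ge0// addr_ge0 ?mulr_ge0//; lra.
  by lra.
have [_ ss] := near_dist hn; rewrite mulr0 addr0.
suff [c cw e] : exists2 c, `|c| <= `|t| &
    stein z (w + t) - stein z w = t * dstein z (w + c).
  rewrite e -mulrBr normrM -(real_normK (num_real t)) expr2 -mulrA ler_wpM2l//.
  apply: (le_trans (dstein_diff z w c)).
  rewrite (_ : (`|w - z| <= `|c|) = false) ?addr0; last first.
    by apply/negP => h; move: hn; rewrite (le_trans h).
  by rewrite ler_wpM2r// addr_ge0 ?mulr_ge0//; lra.
have [t0|t0|->] := ltgtP t 0; last first.
- by exists 0; rewrite ?addr0 ?subrr ?mul0r.
- have wt : w < w + t by lra.
  move: ss; rewrite (min_l (ltW wt)) (max_r (ltW wt)) => ss.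
  have [c /andP[wc ct] e] := stein_mvt wt ss; exists (c - w).
    by rewrite !gtr0_norm//; lra.
  by rewrite e [w + (c - w)]addrC subrK addrAC subrr add0r mulrC.
- have wt : w + t < w by lra.
  move: ss; rewrite (min_r (ltW wt)) (max_l (ltW wt)) => ss.
  have [c /andP[wc ct] e] := stein_mvt wt ss; exists (c - w).
    by rewrite !ltr0_norm//; lra.
  by rewrite -opprB e [w + (c - w)]addrC subrK; ring.
Qed.

End Gauss.

(** * Berry-Esseen bound for sums of independent copies *)

Section IidSum.
Variables (R : realType) (K : finType) (p xi : K -> R).
Hypothesis p0 : forall x, 0 <= p x.
Hypothesis p1 : \sum_x p x = 1.

(* [isum n h] is the expectation of [h S] where [S] is the sum of [n]
   independent copies of the random variable [xi] under the law [p]. *)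
Fixpoint isum (n : nat) (h : R -> R) : R :=
  if n is m.+1 then \sum_x p x * isum m (fun s => h (s + xi x)) else h 0.

Lemma eq_isum n h h' : h =1 h' -> isum n h = isum n h'.
Proof. by move=> /funext ->. Qed.

Lemma isumD n h h' : isum n (fun s => h s + h' s) = isum n h + isum n h'.
Proof.
elim: n h h' => [//|n IH] h h' /=.
by rewrite -big_split/=; apply: eq_bigr => x _; rewrite IH mulrDr.
Qed.

Lemma isumZ n a h : isum n (fun s => a * h s) = a * isum n h.
Proof.
elim: n h => [//|n IH] h /=.
by rewrite mulr_sumr; apply: eq_bigr => x _; rewrite IH mulrCA.
Qed.

Lemma isum_cst n a : isum n (fun=> a) = a.
Proof.
elim: n => [//|n IH] /=.
by under eq_bigr do rewrite IH; rewrite -mulr_suml p1 mul1r.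
Qed.

Lemma isumB n h h' : isum n (fun s => h s - h' s) = isum n h - isum n h'.
Proof.
rewrite -[- isum _ _]mulN1r -isumZ -isumD.
by apply: eq_isum => s; rewrite mulN1r.
Qed.

Lemma le_isum n h h' : (forall s, h s <= h' s) -> isum n h <= isum n h'.
Proof.
elim: n h h' => [|n IH] h h' hh' /=; first exact: hh'.
by apply: ler_sum => x _; rewrite ler_wpM2l// IH.
Qed.

Lemma ler_norm_isum n h : `|isum n h| <= isum n (fun s => `|h s|).
Proof.
rewrite ler_norml -mulN1r -isumZ; apply/andP; split; apply: le_isum => s.
  by rewrite mulN1r lerNl -normrN ler_norm.
exact: ler_norm.
Qed.

(** Exchangeability: all n + 1 summands contribute equally to E[S f(S)], so one of them is singled
    out and the rest is a sum of n copies. *)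
Lemma isum_size_bias n f :
  isum n.+1 (fun s => s * f s) =
  n.+1%:R * \sum_x p x * xi x * isum n (fun s => f (s + xi x)).
Proof.
elim: n f => [|n IH] f.
  rewrite /= mul1r; apply: eq_bigr => x _.
  by rewrite add0r mulrA.
have -> : isum n.+2 (fun s => s * f s) =
    \sum_x p x * isum n.+1 (fun s => s * f (s + xi x)) +
    \sum_x p x * xi x * isum n.+1 (fun s => f (s + xi x)).
  rewrite -big_split/=; apply: eq_bigr => x _.
  rewrite -mulrA -mulrDr; congr (_ * _).
  rewrite -/(isum n.+1 (fun s => (s + xi x) * f (s + xi x))).
  rewrite -/(isum n.+1 (fun s => s * f (s + xi x))).
  rewrite -/(isum n.+1 (fun s => f (s + xi x))).
  rewrite -isumZ -isumD; apply: eq_isum => s; ring.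
rewrite [n.+2%:R]mulrSr mulrDl mul1r; congr (_ + _).
under eq_bigr do rewrite IH mulrCA mulr_sumr.
rewrite -mulr_sumr; congr (_ * _); rewrite exchange_big/=.
apply: eq_bigr => y _; rewrite mulr_sumr; apply: eq_bigr => x _.
rewrite mulrCA; congr (_ * (_ * _)); apply: eq_isum => s.
by rewrite addrAC.
Qed.

Section Centered.
Variables (n : nat) (b : R).
Hypothesis mean0 : \sum_x p x * xi x = 0.
Hypothesis var1 : n.+1%:R * (\sum_x p x * xi x ^+ 2) = 1.
Hypothesis xi_le : forall x, `|xi x| <= b.

Lemma isum_mean m : isum m id = 0.
Proof.
case: m => [//|m].
have -> : isum m.+1 id = isum m.+1 (fun s => s * 1).
  by apply: eq_isum => s; rewrite mulr1.
rewrite isum_size_bias; under eq_bigr do rewrite isum_cst mulr1.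
by rewrite mean0 mulr0.
Qed.

Lemma isum_sqr m : isum m (fun s => s * s) = m%:R * \sum_x p x * xi x ^+ 2.
Proof.
case: m => [|m]; first by rewrite /= !mul0r.
rewrite (isum_size_bias m id); congr (_ * _); apply: eq_bigr => x _.
by rewrite isumD isum_mean isum_cst add0r -mulrA expr2.
Qed.

Lemma isum_abs m : (m <= n.+1)%N -> isum m (fun s => `|s|) <= 1.
Proof.
move=> mn.
have v0 : 0 <= \sum_x p x * xi x ^+ 2.
  by apply: sumr_ge0 => x _; rewrite mulr_ge0// sqr_ge0.
have v1 : isum m (fun s => s * s) <= 1.
  by rewrite isum_sqr -[leRHS]var1 ler_wpM2r// ler_nat.
have : isum m (fun s => `|s|) <= isum m (fun s => 2^-1 * (1 + s * s)).
  apply: le_isum => s; have := sqr_ge0 (`|s| - 1).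
  by rewrite sqrrB real_normK ?num_real// expr2; lra.
by rewrite isumZ isumD isum_cst; lra.
Qed.

(** As [xi] has mean zero, anything independent of the singled-out copy may be subtracted; this is
    how increments over one copy appear. *)
Lemma isum_centered (F : K -> R -> R) (h : R -> R) :
  n.+1%:R * (\sum_x p x * xi x * isum n (F x)) =
  n.+1%:R * (\sum_x p x * xi x * isum n (fun s => F x s - h s)).
Proof.
congr (_ * _); under [RHS]eq_bigr do rewrite isumB mulrBr.
by rewrite sumrB -mulr_suml mean0 mul0r subr0.
Qed.

Lemma isum_var h :
  n.+1%:R * (\sum_x p x * xi x ^+ 2 * isum n h) = isum n h.
Proof. by rewrite -mulr_suml mulrA var1 mul1r. Qed.

Definition clip (c w : R) : R := Num.max (- c) (Num.min c w).

Lemma clip_norm c w : 0 <= c -> `|clip c w| <= c.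
Proof.
move=> c0; rewrite ler_norml /clip le_max lexx/= ge_max ge_min lexx/= andbT.
by lra.
Qed.

Lemma clip_diff_ge0 c w t : 0 <= t * (clip c (w + t) - clip c w).
Proof.
have clip_le u v : u <= v -> clip c u <= clip c v.
  by move=> uv; rewrite /clip ge_max le_max lexx/= le_max !le_min !ge_min lexx uv/= !orbT.
case: (leP 0 t) => t0.
  by rewrite mulr_ge0// subr_ge0 clip_le//; lra.
by rewrite mulr_le0 ?(ltW t0)// subr_le0 clip_le//; lra.
Qed.

Lemma clip_id c w : `|w| <= c -> clip c w = w.
Proof. by rewrite ler_norml => /andP[w1 w2]; rewrite /clip min_r// max_r. Qed.

(* Concentration: the size-biased identity applied to a clipped linear function. *)
Lemma isum_concentration z : isum n (fun s => (`|s - z| <= b)%R%:R) <= 2 * b.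
Proof.
have [x0 _|K0] := pickP [pred x : K | true]; last first.
  by move: p1; rewrite big_pred0// => /eqP; rewrite eq_sym oner_eq0.
have b0 : 0 <= b by apply: le_trans (xi_le x0).
(* Clipping at 2b rather than b: from |s - z| <= b a step |xi| <= b stays in the linear range, so
   the increment of [F] is exactly [xi x]. Elsewhere monotonicity makes increment times [xi x]
   nonnegative. *)
pose F w := clip (2 * b) (w - z).
have h1 : isum n.+1 (fun s => s * F s) <= 2 * b.
  apply: le_trans (_ : isum n.+1 (fun s => 2 * b * `|s|) <= _).
    apply: le_isum => s; apply: le_trans (ler_norm _) _.
    rewrite normrM mulrC ler_wpM2r// clip_norm//; lra.
  by rewrite isumZ ler_piMr ?isum_abs//; lra.
apply: (le_trans _ h1); rewrite isum_size_bias (isum_centered _ F) -isum_var.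
rewrite ler_wpM2l//; apply: ler_sum => x _.
rewrite expr2 -!mulrA ler_wpM2l// -!isumZ; apply: le_isum => s.
rewrite /F addrAC; case: (leP `|s - z| b) => h; last by rewrite mulr0n !mulr0 clip_diff_ge0.
have hx := xi_le x.
have h2 : `|s - z| <= 2 * b by lra.
have h3 : `|s - z + xi x| <= 2 * b by apply: (le_trans (ler_normD _ _)); lra.
by rewrite (clip_id h2) (clip_id h3) addrAC subrr add0r mulr1n mulr1.
Qed.

(** Stein's equation at the full sum S' writes the error as E dstein(S') - E[S' stein(S')]. Both
    terms are compared with E dstein(S), where S omits one copy. With E|S| <= 1 and concentration
    2b, the two comparisons cost (4 + [stein_cst]) b and (10 + [stein_cst]) b. *)
Lemma berry_esseen_normalized z :
  `|isum n.+1 (fun s => (s <= z)%R%:R) - Phi z| <= (14 + 2 * stein_cst R) * b.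
Proof.
have [x0 _|K0] := pickP [pred x : K | true]; last first.
  by move: p1; rewrite big_pred0// => /eqP; rewrite eq_sym oner_eq0.
have b0 : 0 <= b by apply: le_trans (xi_le x0).
have c1 := stein_cst_ge1 R.
have absn : isum n (fun s => `|s|) <= 1 by exact: isum_abs.
have conc := isum_concentration z.
have e : isum n.+1 (fun s => (s <= z)%R%:R) - Phi z =
    \sum_x p x * isum n (fun s => dstein z (s + xi x) - dstein z s) -
    n.+1%:R * \sum_x p x * xi x *
      isum n (fun s => stein z (s + xi x) - stein z s - xi x * dstein z s).
  have -> : \sum_x p x * isum n (fun s => dstein z (s + xi x) - dstein z s) =
      isum n.+1 (dstein z) - isum n (dstein z).
    under eq_bigr do rewrite isumB mulrBr.
    by rewrite sumrB -mulr_suml p1 mul1r.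
  have -> : n.+1%:R * \sum_x p x * xi x *
      isum n (fun s => stein z (s + xi x) - stein z s - xi x * dstein z s) =
      isum n.+1 (fun s => s * stein z s) - isum n (dstein z).
    rewrite isum_size_bias [X in _ = X - _](isum_centered _ (stein z)) -[isum n (dstein z)]isum_var.
    rewrite -mulrBr -sumrB; congr (_ * _); apply: eq_bigr => x _.
    by rewrite isumB isumZ; ring.
  have -> : isum n.+1 (dstein z) = isum n.+1 (fun s => s * stein z s) +
      isum n.+1 (fun s => (s <= z)%R%:R) - Phi z.
    by rewrite isumB isumD isum_cst.
  by ring.
have A1 : `|\sum_x p x * isum n (fun s => dstein z (s + xi x) - dstein z s)| <=
    b * (2 + stein_cst R) + 2 * b.
  apply: (le_trans (ler_norm_sum _ _ _)).
  apply: le_trans (_ : \sum_x p x * (b * (2 + stein_cst R) + 2 * b) <= _); last first.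
    by rewrite -mulr_suml p1 mul1r.
  apply: ler_sum => x _; rewrite normrM ger0_norm// ler_wpM2l//.
  apply: (le_trans (ler_norm_isum _ _)).
  apply: le_trans (_ : isum n (fun s => b * (2 * `|s| + stein_cst R) +
    (`|s - z| <= b)%R%:R) <= _).
    apply: le_isum => s; apply: (le_trans (dstein_diff _ _ _)); apply: lerD.
      by rewrite ler_wpM2r//; have := normr_ge0 s; lra.
    by rewrite ler_nat; case: (leP `|s - z| `|xi x|) => // h; rewrite (le_trans h).
  rewrite isumD isumZ isumD isumZ isum_cst; apply: lerD => //.
  by rewrite ler_wpM2l//; lra.
have A2 : `|n.+1%:R * \sum_x p x * xi x *
      isum n (fun s => stein z (s + xi x) - stein z s - xi x * dstein z s)| <=
    b * (2 + stein_cst R) + 8 * b.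
  (* [var1] lets the constant bound be written as an average with weights
     [n.+1%:R * p x * xi x ^+ 2], so that the comparison can be made term by term in [x]. *)
  rewrite -[leRHS](isum_cst n) -isum_var isum_cst normrM ger0_norm// ler_wpM2l//.
  apply: (le_trans (ler_norm_sum _ _ _)); apply: ler_sum => x _.
  rewrite !normrM ger0_norm// -!mulrA ler_wpM2l//.
  rewrite [leRHS]mulrA -expr2 -(real_normK (num_real (xi x))) expr2 -mulrA ler_wpM2l//.
  apply: (le_trans (ler_norm_isum _ _)).
  apply: le_trans (_ : isum n (fun s => `|xi x| * (b * (2 * `|s| + stein_cst R) +
    4 * (`|s - z| <= b)%R%:R)) <= _).
    apply: le_isum => s; apply: (le_trans (stein_taylor _ _ _)).
    rewrite [leRHS]mulrDr; apply: lerD.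
      rewrite -(real_normK (num_real (xi x))) expr2 -mulrA ler_wpM2l//.
      by rewrite ler_wpM2r//; have := normr_ge0 s; lra.
    rewrite [leRHS]mulrCA mulrA ler_wpM2l ?mulr_ge0//.
    by rewrite ler_nat; case: (leP `|s - z| `|xi x|) => // h; rewrite (le_trans h).
  rewrite isumZ ler_wpM2l// isumD !isumZ isumD isumZ isum_cst; apply: lerD; last lra.
  by rewrite ler_wpM2l//; lra.
rewrite e; apply: (le_trans (ler_normB _ _)).
by apply: (le_trans (lerD A1 A2)); lra.
Qed.

End Centered.
End IidSum.

(** * Quantiles of sums of independent copies, up to a bounded shift *)

Section Quantiles.
Variable R : realType.

Definition ffun_cons (n : nat) (K : Type) (x : K) (i : {ffun 'I_n -> K}) :
    {ffun 'I_n.+1 -> K} :=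
  [ffun k => if unlift ord0 k is Some j then i j else x].

Lemma sum_ffun_cons (n : nat) (K : finType) (F : {ffun 'I_n.+1 -> K} -> R) :
  \sum_i F i = \sum_x \sum_i F (ffun_cons x i).
Proof.
rewrite pair_big/=.
rewrite (reindex (fun q : K * {ffun 'I_n -> K} => ffun_cons q.1 q.2))//=.
exists (fun i : {ffun 'I_n.+1 -> K} => (i ord0, [ffun j => i (lift ord0 j)])).
  move=> [x i] _ /=; rewrite ffunE unlift_none; congr pair.
  by apply/ffunP => j; rewrite !ffunE liftK.
move=> i _; apply/ffunP => k; rewrite !ffunE/=.
by case: unliftP => [j|] -> //; rewrite ffunE.
Qed.

Lemma ffun_cons0 (n : nat) (K : Type) (x : K) (i : {ffun 'I_n -> K}) :
  ffun_cons x i ord0 = x.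
Proof. by rewrite ffunE unlift_none. Qed.

Lemma ffun_cons_lift (n : nat) (K : Type) (x : K) (i : {ffun 'I_n -> K}) j :
  ffun_cons x i (lift ord0 j) = i j.
Proof. by rewrite ffunE liftK. Qed.

Lemma isum_ffun (K : finType) (p xi : K -> R) (n : nat) (h : R -> R) :
  \sum_(i : {ffun 'I_n -> K}) (\prod_k p (i k)) * h (\sum_k xi (i k)) =
  isum p xi n h.
Proof.
elim: n h => [|n IH] h.
  rewrite (eq_bigr (fun=> h 0)) => [|i _]; last by rewrite !big_ord0 mul1r.
  by rewrite sumr_const card_ffun card_ord expn0.
rewrite sum_ffun_cons /=; apply: eq_bigr => x _.
rewrite -IH mulr_sumr; apply: eq_bigr => i _.
rewrite !big_ord_recl !ffun_cons0 mulrA; congr (_ * _ * h _).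
  by apply: eq_bigr => k _; rewrite ffun_cons_lift.
by rewrite addrC; congr (_ + _); apply: eq_bigr => k _; rewrite ffun_cons_lift.
Qed.

Variables (K : finType) (p X : K -> R).
Hypothesis p0 : forall x, 0 <= p x.
Hypothesis p1 : \sum_x p x = 1.

Definition mean : R := \sum_x p x * X x.
Definition variance : R := \sum_x p x * X x ^+ 2 - mean ^+ 2.

Definition sum_cdf (n : nat) (l : R) : R :=
  \sum_(i : {ffun 'I_n -> K}) (\prod_k p (i k)) * (\sum_k X (i k) <= l)%R%:R.

Lemma varianceE : variance = \sum_x p x * (X x - mean) ^+ 2.
Proof.
rewrite /variance [RHS](eq_bigr (fun x => p x * X x ^+ 2 - 2 * mean * (p x * X x) + mean ^+ 2 * p x)).
  by rewrite big_split/= sumrB -!mulr_sumr p1 -/mean; ring.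
by move=> x _; ring.
Qed.

Lemma variance_ge0 : 0 <= variance.
Proof. by rewrite varianceE sumr_ge0// => x _; rewrite mulr_ge0// sqr_ge0. Qed.

Lemma berry_esseen : 0 < variance -> exists2 C : R, 0 <= C &
  forall n z, `|sum_cdf n.+1 (n.+1%:R * mean + Num.sqrt (n.+1%:R * variance) * z) - Phi z|
    <= C / Num.sqrt n.+1%:R.
Proof.
move=> V0; have c1 := stein_cst_ge1 R.
(* A crude uniform bound on the deviations of [X]; after division by sqrt((n+1) V) it is the [b] of
   the normalised bound and carries the rate 1/sqrt n. *)
pose M := \sum_x `|X x - mean|.
have M0 : 0 <= M by apply: sumr_ge0.
exists ((14 + 2 * stein_cst R) * (M / Num.sqrt variance)).
  by rewrite mulr_ge0 ?divr_ge0 ?sqrtr_ge0//; lra.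
move=> n z; pose s := Num.sqrt (n.+1%:R * variance).
have s0 : 0 < s by rewrite sqrtr_gt0 mulr_gt0.
pose xi x := (X x - mean) / s.
have mean0 : \sum_x p x * xi x = 0.
  rewrite (eq_bigr (fun x => (p x * X x - p x * mean) / s)); last first.
    by move=> x _; rewrite /xi mulrA mulrBr.
  by rewrite -mulr_suml sumrB -mulr_suml p1 mul1r subrr mul0r.
have var1 : n.+1%:R * (\sum_x p x * xi x ^+ 2) = 1.
  rewrite (eq_bigr (fun x => p x * (X x - mean) ^+ 2 * (s ^+ 2)^-1)); last first.
    by move=> x _; rewrite /xi exprMn exprVn mulrA.
  rewrite -mulr_suml -varianceE sqr_sqrtr ?mulr_ge0 ?(ltW V0)//.
  by rewrite mulrA divff// mulf_neq0// ?pnatr_eq0// gt_eqF.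
have xi_le x : `|xi x| <= M / s.
  rewrite /xi normrM (ger0_norm (_ : 0 <= s^-1)) ?invr_ge0 ?(ltW s0)//.
  rewrite ler_wpM2r ?invr_ge0 ?(ltW s0)// /M (bigD1 x)//= lerDl.
  exact: sumr_ge0.
have := berry_esseen_normalized p0 p1 mean0 var1 xi_le z.
rewrite -isum_ffun.
have -> : \sum_(i : {ffun 'I_n.+1 -> K}) \prod_k p (i k) * (\sum_k xi (i k) <= z)%R%:R =
    sum_cdf n.+1 (n.+1%:R * mean + s * z).
  apply: eq_bigr => i _; congr (_ * _%:R); congr nat_of_bool.
  rewrite /xi -mulr_suml ler_pdivrMr// sumrB sumr_const card_ord lerBlDr.
  by rewrite addrC mulrC mulr_natl.
move=> h; apply: (le_trans h).
rewrite -!mulrA ler_wpM2l//; first by lra.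
by rewrite ler_wpM2l// -invfM /s sqrtrM// mulrC.
Qed.

Lemma Phi_surj (eps : R) : 0 < eps -> eps < 1 -> Phi (Phi_inv eps) = eps.
Proof.
move=> e0 e1; rewrite /Phi_inv; apply: (@xgetPex _ 0 [set x | Phi x = eps]).
have [a ha] : exists a, @Phi R a < eps.
  have /cvgrPdist_lt/(_ _ e0) := @cvg_Phi_ninfty R.
  move=> h; have [M [_ hM]] := h; exists (M - 1).
  have /hM/= : M - 1 < M by lra.
  by rewrite sub0r normrN ger0_norm// Phi_ge0.
have [b hb] : exists b, eps < @Phi R b.
  have e10 : 0 < 1 - eps by lra.
  have /cvgrPdist_lt/(_ _ e10) := @cvg_Phi_pinfty R.
  move=> h; have [M [_ hM]] := h; exists (M + 1).
  have /hM/= : M < M + 1 by lra.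
  by rewrite ger0_norm ?subr_ge0 ?Phi_le1//; lra.
have ab : a <= b.
  by rewrite leNgt; apply/negP => /ltW/Phi_le; lra.
have [||c _ hc] := @IVT R (@Phi R) a b eps ab.
- apply: derivable_within_continuous => x _.
  exact: (@ex_derive _ _ _ _ _ _ _ (is_derive_Phi x)).
- by rewrite min_l ?max_r ?(ltW ha) ?(ltW hb)//; lra.
by exists c.
Qed.

(** On [x - 1, x + 1] the density is at least phi(|x| + 1). This converts an error in probability
    into a shift of the quantile of the same order. *)
Lemma Phi_increment (x : R) : exists2 c : R, 0 < c &
  forall h, 0 <= h <= 1 -> Phi x + c * h <= Phi (x + h) /\ Phi (x - h) <= Phi x - c * h.
Proof.
pose c := phi (`|x| + 1); exists c; first exact: phi_gt0.
have phi_ge y : x - 1 <= y <= x + 1 -> c <= phi y.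
  move=> yx; rewrite /c !phiE ler_wpM2l ?normal_peak_ge0// ler_expR lerN2.
  rewrite ler_wpM2r// -(real_normK (num_real y)) ler_pXn2r ?nnegrE ?addr_ge0//.
  by rewrite ler_norml; have := ler_norm x; have := ler_norm (- x); rewrite normrN; lra.
have incr a b : x - 1 <= a -> b <= x + 1 -> a <= b -> c * (b - a) <= Phi b - Phi a.
  move=> xa bx; rewrite le_eqVlt => /predU1P[->|ab]; first by rewrite !subrr mulr0.
  have [y /andP[ay yb] ->] := MVT_is_derive (@is_derive_Phi R) ab.
  by rewrite ler_wpM2r ?phi_ge//; lra.
move=> h /andP[h0 h1]; split.
  have := incr x (x + h); rewrite [x + h - x]addrAC subrr add0r.
  by move=> H; have := H ltac:(lra) ltac:(lra) ltac:(lra); lra.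
have := incr (x - h) x; rewrite opprB addrCA subrr addr0.
by move=> H; have := H ltac:(lra) ltac:(lra) ltac:(lra); lra.
Qed.

Lemma sum_prod_ffun n : \sum_(i : {ffun 'I_n -> K}) \prod_k p (i k) = 1.
Proof.
rewrite -(bigA_distr_bigA (fun _ x => p x))/=.
by rewrite (eq_bigr (fun=> 1)) ?big1_eq// => k _; rewrite p1.
Qed.

Lemma sum_cdf_deterministic n l : variance = 0 ->
  sum_cdf n l = (n%:R * mean <= l)%R%:R.
Proof.
rewrite varianceE => /eqP; rewrite psumr_eq0 => [/allP h|x _]; last first.
  by rewrite mulr_ge0 ?sqr_ge0.
have {}h x : p x != 0 -> X x = mean.
  move=> px; have := h x (mem_index_enum x); rewrite mulf_eq0 (negbTE px)/=.
  by rewrite sqrf_eq0 subr_eq0 => /eqP.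
rewrite /sum_cdf (eq_bigr (fun i : {ffun 'I_n -> K} =>
    (\prod_k p (i k)) * (n%:R * mean <= l)%R%:R)).
  by rewrite -mulr_suml sum_prod_ffun mul1r.
move=> i _; have [->|/prodf_neq0 pi0] := eqVneq (\prod_k p (i k)) 0.
  by rewrite !mul0r.
congr (_ * (_ <= l)%R%:R); rewrite (eq_bigr (fun=> mean)).
  by rewrite sumr_const card_ord mulr_natl.
by move=> k _; apply: h; exact: pi0.
Qed.

Lemma near_inv_sqrt (a : R) : 0 < a ->
  \forall n \near \oo, (0 < n)%N /\ (Num.sqrt n%:R)^-1 <= a.
Proof.
move=> a0; near=> n.
have n0 : (0 < n)%N by near: n; exact: nbhs_infty_gt.
split => //.
have an : a ^- 2 <= n%:R by near: n; exact: nbhs_infty_ger.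
rewrite invf_ple ?posrE ?sqrtr_gt0 ?ltr0n//.
rewrite -(ger0_norm (_ : 0 <= a^-1)) ?invr_ge0 ?(ltW a0)// -sqrtr_sqr exprVn.
by rewrite ler_sqrt// ltr0n.
Unshelve. all: by end_near. Qed.

(** The margins 4/sqrt n and 1/sqrt n are those consumed later by the converse and by the protocol.
    They cost only a constant [D]: a shift of order 1/sqrt n on the scale of [Phi] is multiplied by
    sqrt(nV). *)
Lemma second_order_quantile (eps : R) : 0 < eps -> eps < 1 ->
  exists D : R, \forall n \near \oo,
    let l := n%:R * mean + Num.sqrt (n%:R * variance) * Phi_inv eps in
    eps + 4 / Num.sqrt n%:R <= sum_cdf n (l + D) /\
    sum_cdf n (l - D) <= eps - (Num.sqrt n%:R)^-1.
Proof.
move=> e0 e1; have [V0|V0] := eqVneq variance 0.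
  (* Zero variance: the distribution function jumps from 0 to 1 at n [mean], so any positive shift
     serves once the margins fit below [eps] and [1 - eps]. *)
  exists 1; near=> n.
  have [_ h1] : (0 < n)%N /\ (Num.sqrt n%:R)^-1 <= eps.
    by near: n; exact: near_inv_sqrt.
  have [_ h2] : (0 < n)%N /\ (Num.sqrt n%:R)^-1 <= (1 - eps) / 4.
    near: n; apply: near_inv_sqrt; lra.
  rewrite /= !sum_cdf_deterministic// V0 mulr0 sqrtr0 mul0r addr0.
  have -> : n%:R * mean <= n%:R * mean + 1 by lra.
  have -> : (n%:R * mean <= n%:R * mean - 1) = false by apply/negP; lra.
  by rewrite mulr1n mulr0n; split; lra.
have {}V0 : 0 < variance by rewrite lt_def V0 variance_ge0.
have [C C0 BE] := berry_esseen V0.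
have [c c0 incr] := Phi_increment (Phi_inv eps).
rewrite (Phi_surj e0 e1) in incr.
(* Shifting by D/sqrt n moves [Phi] by at least (C + 4)/sqrt n: C pays for the Berry-Esseen error, 4
   for the margin. *)
pose D := (C + 4) / c.
have D0 : 0 < D by rewrite divr_gt0//; lra.
exists (Num.sqrt variance * D); near=> n.
have [n0 h1] : (0 < n)%N /\ (Num.sqrt n%:R)^-1 <= D^-1.
  by near: n; apply: near_inv_sqrt; rewrite invr_gt0.
set x := Phi_inv eps in incr *.
pose r : R := (Num.sqrt n%:R)^-1.
have s0 : 0 < Num.sqrt n%:R :> R by rewrite sqrtr_gt0 ltr0n.
have r0 : 0 < r by rewrite invr_gt0.
have Dr : 0 <= D * r <= 1.
  rewrite mulr_ge0 ?(ltW r0) ?(ltW D0)//=.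
  by rewrite mulrC -ler_pdivlMr// mul1r.
have cD : c * (D * r) = (C + 4) * r.
  by rewrite /D mulrA [c * _]mulrC divfK// gt_eqF.
have el : Num.sqrt variance * D = Num.sqrt (n%:R * variance) * (D * r).
  rewrite sqrtrM ?ler0n// /r; field; by rewrite gt_eqF.
have BE' z : `|sum_cdf n (n%:R * mean + Num.sqrt (n%:R * variance) * z) - Phi z| <= C * r.
  by move: (BE n.-1 z); rewrite prednK.
have [i1 i2] := incr _ Dr.
rewrite /= el -!addrA -mulrDr -mulrBr; split.
  have := BE' (x + D * r); rewrite ler_norml => /andP[h _].
  by rewrite -/r; lra.
have := BE' (x - D * r); rewrite ler_norml => /andP[_ h].
by rewrite -/r; lra.
Unshelve. all: by end_near. Qed.

End Quantiles.

(** * Operators and positive maps *)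

Section Operators.
Variable R : realType.
Local Notation C := (complex R).
Implicit Types I J : finType.

Lemma entry_opmx I (f : I -> I -> C) i j : entry (opmx f) i j = f i j.
Proof. by rewrite /entry /opmx mxE !enum_rankK. Qed.

Lemma opP I (X Y : op R I) : (forall i j, entry X i j = entry Y i j) -> X = Y.
Proof.
move=> XY; apply/matrixP => k l.
by have := XY (enum_val k) (enum_val l); rewrite /entry !enum_valK.
Qed.

Lemma entryD I (X Y : op R I) i j : entry (X + Y) i j = entry X i j + entry Y i j.
Proof. by rewrite /entry mxE. Qed.

Lemma entryZ I a (X : op R I) i j : entry (a *: X) i j = a * entry X i j.
Proof. by rewrite /entry mxE. Qed.

Lemma entry_sum I (T : Type) (r : seq T) (P : pred T) (F : T -> op R I) i j :
  entry (\sum_(t <- r | P t) F t) i j = \sum_(t <- r | P t) entry (F t) i j.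
Proof. by rewrite /entry summxE. Qed.

Lemma sum_enum_rank I (F : 'I_#|{: I}| -> C) : \sum_k F k = \sum_i F (enum_rank i).
Proof.
by rewrite (reindex (@enum_rank I))//; exists enum_val => k _; rewrite ?enum_rankK ?enum_valK.
Qed.

Lemma entryM I (X Y : op R I) i j :
  entry (X *m Y) i j = \sum_k entry X i k * entry Y k j.
Proof. by rewrite /entry mxE sum_enum_rank. Qed.

Lemma mxtrace_entry I (X : op R I) : \tr X = \sum_i entry X i i.
Proof. by rewrite /mxtrace sum_enum_rank. Qed.

Lemma entry_ketbra I (i j k l : I) :
  entry (ketbra R i j) k l = (k == i)%:R * (l == j)%:R.
Proof.
by rewrite /entry /ketbra mxE !(inj_eq enum_rank_inj) -natrM mulnb.
Qed.

Lemma entry_tens I J (X : op R I) (Y : op R J) p q :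
  entry (tens X Y) p q = entry X p.1 q.1 * entry Y p.2 q.2.
Proof. exact: entry_opmx. Qed.

Lemma sum_delta I (i : I) (F : I -> C) : \sum_k (i == k)%:R * F k = F i.
Proof.
rewrite (bigD1 i)//= eqxx mul1r big1 ?addr0// => k /negPf ki.
by rewrite eq_sym ki mul0r.
Qed.

Lemma op_decomp I (X : op R I) :
  X = \sum_p \sum_q entry X p q *: ketbra R p q.
Proof.
apply: opP => i j; rewrite entry_sum -[LHS](sum_delta i (fun p => entry X p j)).
apply: eq_bigr => p _; rewrite entry_sum -[in LHS](sum_delta j (entry X p)) mulr_sumr.
by apply: eq_bigr => q _; rewrite entryZ entry_ketbra; ring.
Qed.

Lemma sum_pair I J (F : I * J -> C) : \sum_p F p = \sum_i \sum_j F (i, j).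
Proof. by rewrite pair_bigA; apply: eq_bigr => -[]. Qed.

Lemma sum_unit (F : unit -> C) : \sum_x F x = F tt.
Proof. by rewrite (eq_bigl (pred1 tt)) ?big_pred1_eq//; case. Qed.

Definition qform I (X : op R I) (v w : I -> C) : C :=
  \sum_i \sum_j (v i)^* * entry X i j * w j.

Lemma qformE I (X : op R I) (v : 'cV[C]_#|{: I}|) :
  (v^t* *m X *m v) 0 0 = qform X (fun i => v (enum_rank i) 0) (fun i => v (enum_rank i) 0).
Proof.
rewrite mxE sum_enum_rank /qform exchange_big; apply: eq_bigr => j _ /=.
rewrite mxE sum_enum_rank mulr_suml; apply: eq_bigr => i _.
by rewrite !mxE.
Qed.

Lemma psdP I (X : op R I) : psd X <-> forall v, 0 <= qform X v v.
Proof.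
split=> [h v|h v]; last by rewrite qformE.
have := h (\col_k v (enum_val k)); rewrite qformE.
by congr (0 <= _); apply: eq_bigr => i _; apply: eq_bigr => j _; rewrite !mxE !enum_rankK.
Qed.

Definition outer I (x y : I -> C) : op R I := opmx (fun i j => x i * (y j)^*).

Lemma qform_outer I (x y v w : I -> C) :
  qform (outer x y) v w = (\sum_i (v i)^* * x i) * (\sum_j (y j)^* * w j).
Proof.
rewrite mulr_suml; apply: eq_bigr => i _; rewrite mulr_sumr; apply: eq_bigr => j _.
by rewrite entry_opmx; ring.
Qed.

Lemma psd_outer I (x : I -> C) : psd (outer x x).
Proof.
apply/psdP => v; rewrite qform_outer.
have -> : \sum_j (x j)^* * v j = (\sum_i (v i)^* * x i)^*.
  by rewrite rmorph_sum/=; apply: eq_bigr => i _; rewrite rmorphM/= conjCK mulrC.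
exact: mul_conjC_ge0.
Qed.

Lemma qformD I (X Y : op R I) v w : qform (X + Y) v w = qform X v w + qform Y v w.
Proof.
rewrite /qform -big_split; apply: eq_bigr => i _ /=; rewrite -big_split.
by apply: eq_bigr => j _ /=; rewrite entryD; ring.
Qed.

Lemma psd_sum I (T : Type) (r : seq T) (P : pred T) (F : T -> op R I) :
  (forall t, P t -> psd (F t)) -> psd (\sum_(t <- r | P t) F t).
Proof.
move=> h; elim/big_ind: _ => [|X Y /psdP hX /psdP hY|]; last exact: h.
  apply/psdP => v; rewrite /qform big1// => i _; rewrite big1// => j _.
  by rewrite /entry mxE mulr0 mul0r.
by apply/psdP => v; rewrite qformD addr_ge0.
Qed.

(** The new form at [v] is the form of [X] at the push-forward of [v], which sums over fibres; so
    [h] may be any relabelling, embedding or collapse of indices. *)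
Lemma psd_pull I J (h : J -> I) (X : op R I) : psd X ->
  psd (opmx (fun i j => entry X (h i) (h j))).
Proof.
move=> /psdP hX; apply/psdP => v.
suff -> : qform (opmx (fun i j => entry X (h i) (h j))) v v =
    qform X (fun a => \sum_(i | h i == a) v i) (fun a => \sum_(i | h i == a) v i) by [].
rewrite /qform (partition_big h predT)//=; apply: eq_bigr => a _.
transitivity (\sum_(i | h i == a) \sum_b \sum_(j | h j == b) (v i)^* * entry X a b * v j).
  apply: eq_bigr => i /eqP <-; rewrite (partition_big h predT)//=.
  by apply: eq_bigr => b _; apply: eq_bigr => j /eqP <-; rewrite entry_opmx.
rewrite exchange_big/=; apply: eq_bigr => b _.
rewrite rmorph_sum/= !mulr_suml; apply: eq_bigr => i _.
by rewrite mulr_sumr.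
Qed.

Lemma psd_tr I (X : op R I) : psd X -> psd (opmx (fun i j => entry X j i)).
Proof.
move=> /psdP hX; apply/psdP => v.
suff -> : qform (opmx (fun i j => entry X j i)) v v =
    qform X (fun i => (v i)^*) (fun i => (v i)^*) by [].
rewrite /qform exchange_big/=; apply: eq_bigr => i _; apply: eq_bigr => j _.
by rewrite entry_opmx conjCK; ring.
Qed.

Section Linear.
Variables (I J : finType) (f : superop R I J).
Hypothesis lf : linear f.

Lemma linear_fun0 : f 0 = 0.
Proof. by have := lf (-1) 0 0; rewrite scaler0 addr0 scaleN1r addNr. Qed.

Lemma linear_funD X Y : f (X + Y) = f X + f Y.
Proof. by have := lf 1 X Y; rewrite !scale1r. Qed.

Lemma linear_funZ a X : f (a *: X) = a *: f X.
Proof. by have := lf a X 0; rewrite linear_fun0 !addr0. Qed.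

Lemma linear_fun_sum (T : Type) (r : seq T) (P : pred T) (F : T -> op R I) :
  f (\sum_(t <- r | P t) F t) = \sum_(t <- r | P t) f (F t).
Proof. exact: (big_morph f linear_funD linear_fun0). Qed.

Lemma entry_linear X a b :
  entry (f X) a b = \sum_p \sum_q entry X p q * entry (f (ketbra R p q)) a b.
Proof.
rewrite {1}(op_decomp X) linear_fun_sum entry_sum; apply: eq_bigr => p _.
rewrite linear_fun_sum entry_sum; apply: eq_bigr => q _.
by rewrite linear_funZ entryZ.
Qed.

End Linear.

Lemma linear_idfun I : linear (idfun : superop R I I).
Proof. by []. Qed.

Lemma entry_tens_map I J I' J' (f : superop R I I') (g : superop R J J') X u v :
  entry (tens_map f g X) u v = \sum_p \sum_q entry X p q *
    (entry (f (ketbra R p.1 q.1)) u.1 v.1 * entry (g (ketbra R p.2 q.2)) u.2 v.2).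
Proof.
rewrite entry_sum; apply: eq_bigr => p _; rewrite entry_sum; apply: eq_bigr => q _.
by rewrite entryZ entry_tens.
Qed.

Lemma linear_tens_map I J I' J' (f : superop R I I') (g : superop R J J') :
  linear (tens_map f g).
Proof.
move=> a X Y; apply: opP => u v.
rewrite entryD entryZ !entry_tens_map mulr_sumr -big_split; apply: eq_bigr => p _ /=.
rewrite mulr_sumr -big_split; apply: eq_bigr => q _ /=.
by rewrite entryD entryZ; ring.
Qed.

(** The computation rule behind most facts on [tens_map]. Linearity enters because [tens_map]
    evaluates [g] on matrix units only. *)
Lemma tens_map_idl I J J' (g : superop R J J') (X : op R (I * J)) i i' b b' :
  linear g ->
  entry (tens_map idfun g X) (i, b) (i', b') =
  entry (g (opmx (fun j j' => entry X (i, j) (i', j')))) b b'.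
Proof.
move=> lg; rewrite entry_tens_map (entry_linear lg).
rewrite sum_pair/=.
transitivity (\sum_p1 (i == p1)%:R * \sum_p2 \sum_q2 \sum_q1 (i' == q1)%:R *
   (entry X (p1, p2) (q1, q2) * entry (g (ketbra R p2 q2)) b b')).
  apply: eq_bigr => p1 _; rewrite mulr_sumr; apply: eq_bigr => p2 _.
  rewrite sum_pair/=.
  rewrite exchange_big mulr_sumr; apply: eq_bigr => q2 _ /=.
  rewrite mulr_sumr; apply: eq_bigr => q1 _; rewrite entry_ketbra; ring.
rewrite sum_delta; apply: eq_bigr => p2 _; apply: eq_bigr => q2 _.
by rewrite sum_delta entry_opmx.
Qed.

Definition swap_op I J (X : op R (I * J)) : op R (J * I) :=
  opmx (fun p q => entry X (p.2, p.1) (q.2, q.1)).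

Lemma tens_map_swap I J I' J' (f : superop R I I') (g : superop R J J') X :
  tens_map f g X = swap_op (tens_map g f (swap_op X)).
Proof.
apply: opP => -[a b] [a' b']; rewrite entry_opmx !entry_tens_map/=.
rewrite (reindex (fun p : J * I => (p.2, p.1)))/=; last first.
  by exists (fun p => (p.2, p.1)) => -[].
apply: eq_bigr => p _; rewrite (reindex (fun p : J * I => (p.2, p.1)))/=; last first.
  by exists (fun p => (p.2, p.1)) => -[].
by apply: eq_bigr => q _; rewrite entry_opmx/=; ring.
Qed.

Lemma tens_map_idr I J I' (f : superop R I I') (X : op R (I * J)) a a' j j' :
  linear f ->
  entry (tens_map f idfun X) (a, j) (a', j') =
  entry (f (opmx (fun i i' => entry X (i, j) (i', j')))) a a'.
Proof.
move=> lf; rewrite tens_map_swap entry_opmx/= tens_map_idl//.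
congr (entry (f _) _ _); apply: opP => i i'.
by rewrite !entry_opmx.
Qed.

Lemma tens_map_comp I J I' J' (f : superop R I I') (g : superop R J J') X :
  linear f -> linear g ->
  tens_map f g X = tens_map idfun g (tens_map f idfun X).
Proof.
move=> lf lg; apply: opP => -[a b] [a' b']; rewrite tens_map_idl// (entry_linear lg).
rewrite entry_tens_map.
rewrite sum_pair/=.
rewrite exchange_big/=; apply: eq_bigr => p2 _.
transitivity (\sum_q2 \sum_p1 \sum_q1 entry X (p1, p2) (q1, q2) *
  (entry (f (ketbra R p1 q1)) a a' * entry (g (ketbra R p2 q2)) b b')).
  rewrite [RHS]exchange_big/=; apply: eq_bigr => p1 _.
  rewrite sum_pair/=.
  by rewrite [LHS]exchange_big.
apply: eq_bigr => q2 _; rewrite entry_opmx tens_map_idr// (entry_linear lf).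
rewrite mulr_suml; apply: eq_bigr => p1 _; rewrite mulr_suml; apply: eq_bigr => q1 _.
by rewrite entry_opmx mulrA.
Qed.

Section CompletelyPositive.
Variables (I I' : finType) (f : superop R I I').
Hypothesis cpf : completely_positive f.

Let lf : linear f := cpf.1.

(** Complete positivity is defined with ancillas ['I_k]; enumerating [J] transports it to any finite
    type. *)
Lemma cp_idl J (X : op R (J * I)) : psd X -> psd (tens_map idfun f X).
Proof.
move=> pX; pose h (p : 'I_#|{: J}| * I) : J * I := (enum_val p.1, p.2).
pose h' (p : J * I') : 'I_#|{: J}| * I' := (enum_rank p.1, p.2).
have := psd_pull h' (cpf.2 _ _ (psd_pull h pX)).
congr psd; apply: opP => -[j a] [j' a']; rewrite entry_opmx/= /h'/= !tens_map_idl//.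
congr (entry (f _) _ _); apply: opP => i i'.
by rewrite !entry_opmx /h/= !enum_rankK.
Qed.

Lemma cp_idr J (X : op R (I * J)) : psd X -> psd (tens_map f idfun X).
Proof.
move=> pX; rewrite tens_map_swap; apply: (psd_pull (fun p => (p.2, p.1))).
by apply: cp_idl; exact: (psd_pull (fun p => (p.2, p.1))).
Qed.

Lemma cp_psd X : psd X -> psd (f X).
Proof.
move=> pX; have := cp_idl (psd_pull (fun p : unit * I => p.2) pX).
move/(psd_pull (fun a : I' => (tt, a))); congr psd; apply: opP => a a'.
rewrite entry_opmx tens_map_idl//; congr (entry (f _) _ _); apply: opP => i i'.
by rewrite !entry_opmx.
Qed.

(* Transposing the first factor commutes with [id (x) f], so that conjugating by
   the partial transpose amounts to conjugating by the full transpose. *)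
Lemma cp_ptranspose_idl J (X : op R (J * I)) : psd X ->
  psd (ptranspose2 (tens_map idfun f (ptranspose2 X))).
Proof.
move=> pX; have := psd_tr (cp_idl (psd_tr pX)).
congr psd; apply: opP => -[j a] [j' a']; rewrite !entry_opmx/= !tens_map_idl//.
by congr (entry (f _) _ _); apply: opP => i i'; rewrite !entry_opmx.
Qed.

Lemma ptranspose_idr J (X : op R (I * J)) :
  ptranspose2 (tens_map f idfun (ptranspose2 X)) = tens_map f idfun X.
Proof.
apply: opP => -[a j] [a' j']; rewrite !entry_opmx/= !tens_map_idr//.
by congr (entry (f _) _ _); apply: opP => i i'; rewrite !entry_opmx.
Qed.

End CompletelyPositive.

Lemma ptranspose2K I J (X : op R (I * J)) : ptranspose2 (ptranspose2 X) = X.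
Proof. by apply: opP => -[i j] [i' j']; rewrite !entry_opmx. Qed.

Lemma ptranspose2_sum I J (T : Type) (r : seq T) (P : pred T) (F : T -> op R (I * J)) :
  ptranspose2 (\sum_(t <- r | P t) F t) = \sum_(t <- r | P t) ptranspose2 (F t).
Proof.
apply: opP => p q; rewrite entry_opmx !entry_sum.
by apply: eq_bigr => t _; rewrite entry_opmx.
Qed.

Lemma tr_tens_map_idl I J J' (g : superop R J J') (X : op R (I * J)) : linear g ->
  \tr (tens_map idfun g X) =
  \tr (g (opmx (fun j j' => \sum_i entry X (i, j) (i, j')))).
Proof.
move=> lg; rewrite !mxtrace_entry.
rewrite sum_pair/=.
rewrite exchange_big/=; apply: eq_bigr => b _.
rewrite (entry_linear lg); under eq_bigr do rewrite tens_map_idl// (entry_linear lg).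
rewrite exchange_big/=; apply: eq_bigr => j _; rewrite exchange_big/=; apply: eq_bigr => j' _.
by rewrite entry_opmx mulr_suml; apply: eq_bigr => i _; rewrite entry_opmx.
Qed.

Lemma tr_opmx_ptrace1 I J (X : op R (I * J)) :
  \tr (opmx (fun j j' => \sum_i entry X (i, j) (i, j'))) = \tr X.
Proof.
rewrite !mxtrace_entry.
by rewrite [RHS]sum_pair exchange_big; apply: eq_bigr => j _; rewrite entry_opmx.
Qed.

Lemma tr_swap_op I J (X : op R (I * J)) : \tr (swap_op X) = \tr X.
Proof.
rewrite !mxtrace_entry (reindex (fun p : I * J => (p.2, p.1)))/=; last first.
  by exists (fun p => (p.2, p.1)) => -[].
by apply: eq_bigr => -[i j] _; rewrite entry_opmx.
Qed.

Lemma tr_instrument_idl (T : finType) I J J' (E : T -> superop R J J') (X : op R (I * J)) :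
  instrument E -> \sum_x \tr (tens_map idfun (E x) X) = \tr X.
Proof.
move=> [cpE trE]; under eq_bigr => x _ do rewrite (tr_tens_map_idl _ (cpE x).1).
by rewrite trE tr_opmx_ptrace1.
Qed.

Lemma tr_instrument_idr (T : finType) I J I' (E : T -> superop R I I') (X : op R (I * J)) :
  instrument E -> \sum_x \tr (tens_map (E x) idfun X) = \tr X.
Proof.
move=> iE; under eq_bigr do rewrite tens_map_swap tr_swap_op.
by rewrite tr_instrument_idl// tr_swap_op.
Qed.

Lemma instrument_channel I J (f : superop R I J) :
  channel f -> instrument (fun _ : unit => f).
Proof.
by move=> [cpf trf]; split => // rho; rewrite sum_unit.
Qed.

(* A trace-preserving map that stays positive under conjugation by the partial
   transpose: a common relaxation of all four operation classes. *)
Definition ppt_positive (A B A' B' : finType) (L : superop R (A * B) (A' * B')) :=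
  [/\ linear L, forall X, psd X -> psd (L X),
      forall x, psd (ptranspose2 (L (ptranspose2 (outer x x)))) &
      forall X, \tr (L X) = \tr X].

(** Induction on the rounds: conjugation by the partial transpose leaves Alice's local maps
    unchanged and turns Bob's into maps that are still positive. *)
Lemma LOCC_ppt_positive (A B A' B' : finType) (L : superop R (A * B) (A' * B')) :
  LOCC L -> ppt_positive L.
Proof.
(* The third clause is strengthened from rank-one to all positive operators, since the rest of a
   protocol acts on the output of a round, which is no longer of rank one. *)
move=> locc; suff [h1 h2 h3 h4] : [/\ linear L, forall X, psd X -> psd (L X),
      forall X, psd X -> psd (ptranspose2 (L (ptranspose2 X))) &
      forall X, \tr (L X) = \tr X].
  by split => // x; apply: h3; exact: psd_outer.
elim: locc => {A B L} [A B f g L cf cg defL|A B A1 T E K L iE _ IH defL|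
    A B B1 T E K L iE _ IH defL].
- have lf := cf.1.1; have lg := cg.1.1.
  split.
  + by move=> a X Y; rewrite !defL linear_tens_map.
  + by move=> X pX; rewrite defL tens_map_comp//; apply: cp_idl cg.1 _ _ (cp_idr cf.1 pX).
  + move=> X pX; rewrite defL tens_map_comp//.
    rewrite -[tens_map f idfun _]ptranspose2K (ptranspose_idr cf.1).
    by apply: cp_ptranspose_idl cg.1 _ _ (cp_idr cf.1 pX).
  + move=> X; rewrite defL tens_map_comp//.
    have := tr_instrument_idl (tens_map f idfun X) (instrument_channel cg).
    have := tr_instrument_idr X (instrument_channel cf).
    by rewrite !sum_unit => <- <-.
- split.
  + move=> a X Y; rewrite !defL scaler_sumr -big_split; apply: eq_bigr => x _ /=.
    by rewrite linear_tens_map; have [-> _ _ _] := IH x.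
  + move=> X pX; rewrite defL; apply: psd_sum => x _.
    by have [_ h _ _] := IH x; apply/h/cp_idr => //; exact: iE.1.
  + move=> X pX; rewrite defL ptranspose2_sum; apply: psd_sum => x _.
    have [_ _ h _] := IH x.
    rewrite -[tens_map (E x) idfun _]ptranspose2K (ptranspose_idr (iE.1 x)).
    by apply/h/cp_idr => //; exact: iE.1.
  + move=> X; rewrite defL raddf_sum/= -(tr_instrument_idr X iE).
    by apply: eq_bigr => x _; have [_ _ _ ->] := IH x.
- split.
  + move=> a X Y; rewrite !defL scaler_sumr -big_split; apply: eq_bigr => x _ /=.
    by rewrite linear_tens_map; have [-> _ _ _] := IH x.
  + move=> X pX; rewrite defL; apply: psd_sum => x _.
    by have [_ h _ _] := IH x; apply/h/cp_idl => //; exact: iE.1.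
  + move=> X pX; rewrite defL ptranspose2_sum; apply: psd_sum => x _.
    have [_ _ h _] := IH x.
    rewrite -[tens_map idfun (E x) _]ptranspose2K.
    by apply/h/cp_ptranspose_idl => //; exact: iE.1.
  + move=> X; rewrite defL raddf_sum/= -(tr_instrument_idl X iE).
    by apply: eq_bigr => x _; have [_ _ _ ->] := IH x.
Qed.

End Operators.

(** * Spectral decomposition and inclusions between the operation classes *)

Section Inclusions.
Variable R : realType.
Local Notation C := (complex R).
Implicit Types I J A B : finType.

Lemma channel_idfun I : channel (idfun : superop R I I).
Proof.
split=> [|X]; last exact: erefl.
split=> [|k X pX]; first exact: linear_idfun.
suff -> : tens_map idfun idfun X = X by exact: pX.
by apply: opP => -[i j] [i' j']; rewrite tens_map_idl ?entry_opmx//; exact: linear_idfun.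
Qed.

Lemma one_way_LOCC_LOCC A B A' B' (L : superop R (A * B) (A' * B')) :
  one_way_LOCC L -> LOCC L.
Proof.
move=> [T [E [D [iE cD defL]]]].
apply: (LOCC_alice (E := E) (K := fun x => tens_map idfun (D x)) iE) => [x|].
  exact: (LOCC_local (channel_idfun _) (cD x)).
move=> rho; rewrite defL; apply: eq_bigr => x _.
by rewrite tens_map_comp//; [exact: (iE.1 x).1|exact: (cD x).1.1].
Qed.

(** The form at |i> + a|j>: a = 0 gives the diagonal, a = 1 and a = 'i polarise, and a = 1 or -1
    gives the pair inequalities of the converse. *)
Lemma qform_delta2 I (X : op R I) i j a :
  let v := fun k => (i == k)%:R + a * (j == k)%:R in
  qform X v v = entry X i i + a * entry X i j + a^* * entry X j i +
    a * a^* * entry X j j.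
Proof.
have conj_nat (b : bool) : (b%:R : C)^* = b%:R by rewrite conjC_nat.
have h k : \sum_l entry X k l * ((i == l)%:R + a * (j == l)%:R) =
    entry X k i + a * entry X k j.
  rewrite (eq_bigr (fun l => (i == l)%:R * entry X k l + a * ((j == l)%:R * entry X k l))).
    by rewrite big_split/= -mulr_sumr !sum_delta.
  by move=> l _; ring.
rewrite /= /qform.
rewrite (eq_bigr (fun k => (i == k)%:R * (entry X k i + a * entry X k j) +
   a^* * ((j == k)%:R * (entry X k i + a * entry X k j)))).
  by rewrite big_split/= -mulr_sumr !sum_delta; ring.
move=> k _; under eq_bigr do rewrite -mulrA.
by rewrite -mulr_sumr h rmorphD rmorphM/= !conj_nat; ring.
Qed.

Lemma psd_diag_ge0 I (X : op R I) i : psd X -> 0 <= entry X i i.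
Proof.
by move=> /psdP/(_ (fun k => (i == k)%:R + 0 * (i == k)%:R)); rewrite qform_delta2 conjC0 !mul0r !addr0.
Qed.

(** In the order of [R[i]], [0 <= z] includes that z is real; real values at |i> + |j> and |i> +
    'i|j> force the symmetry. *)
Lemma psd_hermitian I (X : op R I) i j : psd X -> entry X j i = (entry X i j)^*.
Proof.
move=> pX; have real_ge0 (z : C) : 0 <= z -> z^* = z.
  by move=> z0; rewrite conj_Creal// ger0_real.
have hi := real_ge0 _ (psd_diag_ge0 i pX); have hj := real_ge0 _ (psd_diag_ge0 j pX).
move/psdP: pX => h.
have := real_ge0 _ (h (fun k => (i == k)%:R + 1 * (j == k)%:R)).
have := real_ge0 _ (h (fun k => (i == k)%:R + 'i * (j == k)%:R)).
rewrite !qform_delta2 !rmorphD !rmorphM/= !conjCK hi hj conjC1 !mul1r conjCi.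
set x := entry X i j; set y := entry X j i => h1 h2.
have h3 : x^* + y^* = x + y.
  have e : x^* + y^* = entry X i i + x^* + y^* + entry X j j - (entry X i i + entry X j j) by ring.
  by rewrite e h2; ring.
have h4 : - 'i * x^* + 'i * y^* = 'i * x - 'i * y.
  have e : - 'i * x^* + 'i * y^* = (entry X i i + - 'i * x^* + 'i * y^* + - 'i * 'i * entry X j j) -
    (entry X i i - 'i * 'i * entry X j j) by ring.
  by rewrite e h1; ring.
have h5 : y^* - x^* = x - y.
  apply: (mulfI (neq0Ci C)); rewrite mulrBr mulrBr -h4; ring.
have : 2 * y = 2 * x^*.
  have -> : 2 * y = (x + y) - (x - y) by ring.
  by rewrite -h3 -h5; ring.
by apply: mulfI; rewrite pnatr_eq0.
Qed.

Lemma psd_diagonalization I (X : op R I) : psd X ->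
  X = (spectralmx X)^t* *m diag_mx (spectral_diag X) *m spectralmx X /\
  forall t, 0 <= spectral_diag X 0 t.
Proof.
move=> pX; have hX : X \is hermsymmx.
  apply/is_hermitianmxP; rewrite expr0 scale1r; apply/matrixP => k l.
  have := psd_hermitian (enum_val l) (enum_val k) pX.
  by rewrite /entry !enum_valK !mxE.
have /orthomx_spectralP eX := hermitian_normalmx hX.
have uP := spectral_unitarymx X.
rewrite (invmx_unitary uP) in eX; split => // t.
set P := spectralmx X in eX uP *; set d := spectral_diag X in eX *.
have e : diag_mx d = P *m X *m P^t*.
  by rewrite {1}eX !mulmxA (unitarymxP uP) mul1mx -mulmxA (unitarymxP uP) mulmx1.
have -> : d 0 t = ((\col_k (P t k)^*)^t* *m X *m (\col_k (P t k)^*)) 0 0.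
  transitivity (diag_mx d t t); first by rewrite mxE eqxx mulr1n.
  rewrite e !mxE; apply: eq_bigr => k _; rewrite !mxE; congr (_ * _).
  by apply: eq_bigr => l _; rewrite !mxE conjCK.
exact: pX.
Qed.

Lemma psd_spectral I (X : op R I) : psd X ->
  exists x : 'I_#|{: I}| -> I -> C, X = \sum_t outer (x t) (x t).
Proof.
move=> /psd_diagonalization[eX d0].
set P := spectralmx X in eX; set d := spectral_diag X in eX d0.
exists (fun t i => sqrtC (d 0 t) * (P t (enum_rank i))^*).
apply: opP => i j; rewrite entry_sum {1}eX /entry mxE.
apply: eq_bigr => t _; rewrite -[RHS]/(entry _ i j) entry_opmx.
rewrite mul_mx_diag !mxE rmorphM/= conjCK.
have : (sqrtC (d 0 t))^* = sqrtC (d 0 t).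
  by rewrite conj_Creal// ger0_real// sqrtC_ge0.
by have := sqrtCK (d 0 t); move: (sqrtC _) => r <- ->; ring.
Qed.

Lemma psd_tens I J (X : op R I) (Y : op R J) : psd X -> psd Y -> psd (tens X Y).
Proof.
move=> /psd_spectral[x ->] /psd_spectral[y ->].
have -> : tens (\sum_t outer (x t) (x t)) (\sum_s outer (y s) (y s)) =
    \sum_t \sum_s outer (fun p => x t p.1 * y s p.2) (fun p => x t p.1 * y s p.2).
  apply: opP => p q; rewrite entry_tens !entry_sum mulr_suml; apply: eq_bigr => t _.
  rewrite entry_sum mulr_sumr; apply: eq_bigr => s _.
  by rewrite !entry_opmx rmorphM/=; ring.
by apply: psd_sum => t _; apply: psd_sum => s _; exact: psd_outer.
Qed.

Lemma psdZ I (X : op R I) (a : R) : 0 <= a -> psd X -> psd (real_complex R a *: X).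
Proof.
move=> a0 /psdP h; apply/psdP => v.
suff -> : qform (real_complex R a *: X) v v = real_complex R a * qform X v v.
  by rewrite mulr_ge0// ler0c.
rewrite /qform mulr_sumr; apply: eq_bigr => i _; rewrite mulr_sumr.
by apply: eq_bigr => j _; rewrite entryZ; ring.
Qed.

(** The partial transpose of a product term transposes [Q x], and the transpose of a positive
    operator is positive. *)
Lemma SEP_PPT A B A' B' (L : superop R (A * B) (A' * B')) : SEP_map L -> PPT_map L.
Proof.
move=> [cL [N [p [P [Q [p0 p1 PQ eL]]]]]]; split; first exact: cL.
rewrite eL.
have -> : ptranspose2 (\sum_x real_complex R (p x) *: tens (P x) (Q x)) =
    \sum_x real_complex R (p x) *: tens (P x) (opmx (fun i j => entry (Q x) j i)).
  apply: opP => u v; rewrite entry_opmx !entry_sum; apply: eq_bigr => x _.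
  by rewrite !entryZ !entry_tens entry_opmx.
apply: psd_sum => x _; apply: psdZ => //; have [pP pQ] := PQ x.
exact: psd_tens pP (psd_tr pQ).
Qed.

Lemma entry_choi I J (L : superop R I J) p q u v :
  entry (choi L) (p, u) (q, v) = entry (L (ketbra R p q)) u v.
Proof.
rewrite -(sum_delta p (fun p' => entry (L (ketbra R p' q)) u v)) entry_sum.
apply: eq_bigr => p' _.
rewrite -(sum_delta q (fun q' => entry (L (ketbra R p' q')) u v)) entry_sum mulr_sumr.
by apply: eq_bigr => q' _; rewrite entry_tens entry_ketbra/= mulrA.
Qed.

(** For a rank-one input |x><x| the form to be bounded, at [w], equals the form of the partially
    transposed Choi matrix at the product of the conjugate of [x] with [w]. The rank-one clause of
    [ppt_positive] matches this. *)
Lemma PPT_ppt_positive A B A' B' (L : superop R (A * B) (A' * B')) :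
  PPT_map L -> ppt_positive L.
Proof.
move=> [[cpL trL] /psdP pptL]; have lL := cpL.1.
split => //; first by move=> X; exact: cp_psd.
move=> x; apply/psdP => w.
have := pptL (fun P => (x (P.1.1, P.2.1))^* * w (P.1.2, P.2.2)).
congr (0 <= _); rewrite /qform pair_bigA/=.
(* [h] matches the summation indices of the two forms; the exchanged places of [b] and [d] are the
   partial transpose on the input. *)
pose h (y : ((A' * B') * (A' * B')) * ((A * B) * (A * B))) :
    ((A * A') * (B * B')) * ((A * A') * (B * B')) :=
  let: (((a', b'), (c', d')), ((a, d), (c, b))) := y in
  (((a, a'), (b, b')), ((c, c'), (d, d'))).
pose h' (z : ((A * A') * (B * B')) * ((A * A') * (B * B'))) :
    ((A' * B') * (A' * B')) * ((A * B) * (A * B)) :=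
  let: (((a, a'), (b, b')), ((c, c'), (d, d'))) := z in
  (((a', b'), (c', d')), ((a, d), (c, b))).
rewrite (reindex h)/=; last first.
  exists h' => [[[[a' b'] [c' d']] [[a d] [c b]]]|[[[a a'] [b b']] [[c c'] [d d']]]] _ //.
rewrite !pair_bigA/= (eq_bigr (fun y => (w y.1.1)^* * w y.1.2 *
    (entry (ptranspose2 (outer x x)) y.2.1 y.2.2 *
     entry (L (ketbra R y.2.1 y.2.2)) (y.1.1.1, y.1.2.2) (y.1.2.1, y.1.1.2)))).
  rewrite -(pair_bigA _ (fun y1 y2 => (w y1.1)^* * w y1.2 *
    (entry (ptranspose2 (outer x x)) y2.1 y2.2 *
     entry (L (ketbra R y2.1 y2.2)) (y1.1.1, y1.2.2) (y1.2.1, y1.1.2))))/=.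
  apply: eq_bigr => y _; rewrite entry_opmx (entry_linear lL) pair_bigA/= mulrAC.
  by rewrite mulr_sumr.
move=> [[[a' b'] [c' d']] [[a d] [c b]]] _ /=.
rewrite !entry_opmx/= entry_choi rmorphM/= conjCK; ring.
Qed.


End Inclusions.

(** * Converse *)

Section Converse.
Variable R : realType.
Local Notation C := (complex R).
Implicit Types I J A B : finType.

Definition overlap k (Y : op R ('I_k * 'I_k)) : C :=
  k%:R^-1 * \sum_i \sum_j entry Y (i, i) (j, j).

Lemma entry_max_entangled k (p q : 'I_k * 'I_k) :
  entry (max_entangled R k) p q = k%:R^-1 * ((p.1 == p.2)%:R * (q.1 == q.2)%:R).
Proof.
rewrite /max_entangled entryZ entry_sum; congr (_ * _).
case: p q => [a b] [c d] /=.
rewrite -(sum_delta a (fun i => (i == b)%:R * (c == d)%:R)); apply: eq_bigr => i _.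
rewrite entry_sum -(sum_delta c (fun j => (i == b)%:R * (j == d)%:R)) mulr_sumr.
apply: eq_bigr => j _; rewrite entry_ketbra !xpair_eqE -!natrM !mulnb.
by congr (nat_of_bool _)%:R; rewrite (eq_sym b) (eq_sym d); do 4 case: (_ == _).
Qed.

Lemma tr_max_entangled k (Y : op R ('I_k * 'I_k)) :
  \tr (Y *m max_entangled R k) = overlap Y.
Proof.
rewrite mxtrace_entry /overlap sum_pair mulr_sumr.
apply: eq_bigr => a _.
transitivity (\sum_b (a == b)%:R * (k%:R^-1 * \sum_j entry Y (a, b) (j, j))).
  apply: eq_bigr => b _; rewrite entryM sum_pair mulrA mulr_sumr.
  apply: eq_bigr => c _.
  rewrite -(sum_delta c (fun d => (a == b)%:R / k%:R * entry Y (a, b) (c, d))).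
  by apply: eq_bigr => d _; rewrite entry_max_entangled/=; ring.
by rewrite sum_delta.
Qed.

Lemma psd_pair_ge0 I (Y : op R I) p q (b : bool) : psd Y ->
  0 <= entry Y p p + (-1) ^+ b * (entry Y p q + entry Y q p) + entry Y q q.
Proof.
move=> /psdP/(_ (fun k => (p == k)%:R + (-1) ^+ b * (q == k)%:R)).
rewrite qform_delta2; congr (0 <= _).
have -> : ((-1) ^+ b : C)^* = (-1) ^+ b by rewrite rmorphXn/= rmorphN1.
by rewrite -expr2 sqrr_sign; ring.
Qed.

Lemma overlap_ge0 k (Y : op R ('I_k * 'I_k)) : psd Y -> 0 <= overlap Y.
Proof.
move=> /psdP/(_ (fun p => (p.1 == p.2)%:R)) h.
apply: mulr_ge0; first by rewrite invr_ge0 ler0n.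
move: h; congr (0 <= _); rewrite /qform sum_pair; apply: eq_bigr => a _.
transitivity (\sum_b (a == b)%:R * \sum_j entry Y (a, b) (j, j)); last by rewrite sum_delta.
apply: eq_bigr => b _; rewrite sum_pair mulr_sumr; apply: eq_bigr => c _ /=.
rewrite -(sum_delta c (fun d => (a == b)%:R * entry Y (a, b) (c, d))).
by apply: eq_bigr => d _; rewrite conjC_nat; ring.
Qed.

(** Summing the form of [Y] at |ii> - |jj> over all i, j bounds the double sum in [overlap] by k
    times the part of the trace on the |ii>. *)
Lemma overlap_le_tr k (Y : op R ('I_k * 'I_k)) : psd Y -> overlap Y <= \tr Y.
Proof.
move=> pY; case: k Y pY => [|k] Y pY.
  by rewrite /overlap mxtrace_entry sum_pair !big_ord0 mulr0.
pose D := \sum_i entry Y (i, i) (i, i).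
have h1 : D <= \tr Y.
  rewrite mxtrace_entry sum_pair; apply: ler_sum => i _.
  rewrite (bigD1 i)//= lerDl; apply: sumr_ge0 => j _.
  exact: psd_diag_ge0.
apply: le_trans h1; rewrite /overlap mulrC ler_pdivrMr ?ltr0n//.
set S := \sum_i _.
have : 0 <= \sum_i \sum_j (entry Y (i, i) (i, i) + (-1) ^+ true *
    (entry Y (i, i) (j, j) + entry Y (j, j) (i, i)) + entry Y (j, j) (j, j)).
  by apply: sumr_ge0 => i _; apply: sumr_ge0 => j _; exact: psd_pair_ge0.
have -> : \sum_i \sum_j (entry Y (i, i) (i, i) + (-1) ^+ true *
    (entry Y (i, i) (j, j) + entry Y (j, j) (i, i)) + entry Y (j, j) (j, j)) =
    2 * (D * k.+1%:R - S).
  under eq_bigr do rewrite 2!big_split/= sumr_const card_ord -mulr_sumr big_split/=.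
  rewrite 2!big_split/= sumr_const card_ord -mulr_sumr big_split/=.
  have -> : \sum_i \sum_j entry Y (j, j) (i, i) = S by rewrite exchange_big.
  rewrite -/S sumrMnl -/D -mulr_natr; ring.
by rewrite pmulr_rge0 ?ltr0n// subr_ge0.
Qed.

(** The trace of [Y] against the swap operator. *)
Definition flip_tr k (Y : op R ('I_k * 'I_k)) : C :=
  \sum_p entry Y p (p.2, p.1).

(** Swap has eigenvalues 1 and -1; concretely, the form of [Y] is summed over the vectors |p> plus
    or minus |swap p>. Both signs are used in [flip_polar]. *)
Lemma flip_tr_bound k (Y : op R ('I_k * 'I_k)) (b : bool) : psd Y ->
  (-1) ^+ b * flip_tr Y <= \tr Y.
Proof.
move=> pY; have flip_sum (F : 'I_k * 'I_k -> C) : \sum_p F (p.2, p.1) = \sum_p F p.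
  by rewrite [RHS](reindex (fun p => (p.2, p.1)))//; exists (fun p => (p.2, p.1)) => -[].
have : 0 <= \sum_p (entry Y p p + (-1) ^+ (~~ b) *
    (entry Y p (p.2, p.1) + entry Y (p.2, p.1) p) + entry Y (p.2, p.1) (p.2, p.1)).
  by apply: sumr_ge0 => p _; exact: psd_pair_ge0.
rewrite 2!big_split/= -mulr_sumr big_split/= -(flip_sum (fun p => entry Y (p.2, p.1) p)).
rewrite (flip_sum (fun p => entry Y p p)) -mxtrace_entry.
have -> : \sum_p entry Y (((p.2, p.1).2, (p.2, p.1).1)) (p.2, p.1) = flip_tr Y.
  by apply: eq_bigr => -[].
rewrite -/(flip_tr Y).
have -> : \tr Y + (-1) ^+ (~~ b) * (flip_tr Y + flip_tr Y) + \tr Y =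
    2 * (\tr Y - (-1) ^+ b * flip_tr Y) by case: b; rewrite /=; ring.
by rewrite pmulr_rge0 ?ltr0n// subr_ge0.
Qed.

Lemma overlap_flip_tr k (Y : op R ('I_k * 'I_k)) :
  overlap Y = k%:R^-1 * flip_tr (ptranspose2 Y).
Proof.
congr (_ * _); rewrite /flip_tr sum_pair; apply: eq_bigr => i _; apply: eq_bigr => j _.
by rewrite entry_opmx.
Qed.

Section Sesquilinear.
Variables (I : finType) (ell : op R I -> C).
Hypothesis form_linear : forall a X Y, ell (a *: X + Y) = a * ell X + ell Y.

Lemma form0 : ell 0 = 0.
Proof. by have := form_linear (-1) 0 0; rewrite scaler0 addr0 mulN1r addNr. Qed.

Lemma formD X Y : ell (X + Y) = ell X + ell Y.
Proof. by have := form_linear 1 X Y; rewrite scale1r mul1r. Qed.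

Lemma formZ a X : ell (a *: X) = a * ell X.
Proof. by have := form_linear a X 0; rewrite form0 !addr0. Qed.

Lemma form_sum (T : Type) (r : seq T) (P : pred T) (F : T -> op R I) :
  ell (\sum_(t <- r | P t) F t) = \sum_(t <- r | P t) ell (F t).
Proof. exact: (big_morph ell formD form0). Qed.

Lemma form_outer_sum (T : finType) (P : pred T) (a : T -> C) (g : T -> I -> C) :
  ell (outer (fun p => \sum_(t | P t) a t * g t p) (fun p => \sum_(t | P t) a t * g t p)) =
  \sum_(t | P t) \sum_(t' | P t') a t * (a t')^* * ell (outer (g t) (g t')).
Proof.
have -> : outer (fun p => \sum_(t | P t) a t * g t p) (fun p => \sum_(t | P t) a t * g t p) =
    \sum_(t | P t) \sum_(t' | P t') (a t * (a t')^*) *: outer (g t) (g t').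
  apply: opP => i j; rewrite entry_opmx entry_sum mulr_suml; apply: eq_bigr => t _.
  rewrite rmorph_sum/= mulr_sumr entry_sum; apply: eq_bigr => t' _.
  by rewrite entryZ entry_opmx rmorphM/=; ring.
by rewrite form_sum; apply: eq_bigr => t _; rewrite form_sum; apply: eq_bigr => t' _; rewrite formZ.
Qed.

Lemma form_outer2 (a b : R) (x y : I -> C) :
  let w p := real_complex R a * x p + real_complex R b * y p in
  ell (outer w w) = real_complex R (a ^+ 2) * ell (outer x x) +
    real_complex R (a * b) * (ell (outer x y) + ell (outer y x)) +
    real_complex R (b ^+ 2) * ell (outer y y).
Proof.
have conj_rc (z : R) : (real_complex R z)^* = real_complex R z.
  by apply/eqP; rewrite eq_complex/= oppr0 !eqxx.
move=> w; have -> : outer w w = real_complex R (a ^+ 2) *: outer x x +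
    (real_complex R (a * b) *: (outer x y + outer y x) +
    real_complex R (b ^+ 2) *: outer y y).
  apply: opP => i j; rewrite !(entryD, entryZ, entry_opmx) /w !expr2 !(rmorphD, rmorphM)/= !conj_rc.
  by ring.
by rewrite !(formD, formZ) addrA.
Qed.

End Sesquilinear.

Lemma conjC_real_complex (z : R) : (real_complex R z)^* = real_complex R z.
Proof. by apply/eqP; rewrite eq_complex/= oppr0 !eqxx. Qed.

(* [psi = sum_i s_i e_i (x) f_i]; the [f_i] with [s_i = 0] are irrelevant. *)
Record schmidt A B I (psi : A * B -> C) (s : I -> R) (e : I -> A -> C) (f : I -> B -> C) : Prop := {
  schmidt_sum : forall p, psi p = \sum_i real_complex R (s i) * (e i p.1 * f i p.2);
  schmidt_ge0 : forall i, 0 <= s i;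
  schmidt_norm : \sum_i s i ^+ 2 = 1;
  schmidt_orthoA : forall i j, \sum_a (e i a)^* * e j a = (i == j)%:R;
  schmidt_basisA : forall a a', \sum_i e i a * (e i a')^* = (a == a')%:R;
  schmidt_orthoB : forall i j, s i != 0 -> s j != 0 ->
    \sum_b (f i b)^* * f j b = (i == j)%:R }.

Section Bound.
Variables (A B I : finType) (psi : A * B -> C) (s : I -> R) (e : I -> A -> C) (f : I -> B -> C).
Hypothesis sch : schmidt psi s e f.
Variables (k : nat) (L : superop R (A * B) ('I_k * 'I_k)).
Hypotheses (k0 : (0 < k)%N) (posL : ppt_positive L).

Let lL : linear L. Proof. by have [] := posL. Qed.
Let trL X : \tr (L X) = \tr X. Proof. by have [_ _ _ ->] := posL. Qed.

Lemma overlap_linear : forall a X Y, overlap (L (a *: X + Y)) = a * overlap (L X) + overlap (L Y).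
Proof.
move=> a X Y; rewrite lL /overlap mulrCA -mulrDr; congr (_ * _).
rewrite mulr_sumr -big_split; apply: eq_bigr => i _ /=.
rewrite mulr_sumr -big_split; apply: eq_bigr => j _ /=.
by rewrite entryD entryZ.
Qed.

Lemma ptranspose2_linear I1 J1 a (X Y : op R (I1 * J1)) :
  ptranspose2 (a *: X + Y) = a *: ptranspose2 X + ptranspose2 Y.
Proof. by apply: opP => p q; rewrite !(entryD, entryZ, entry_opmx). Qed.

Let H X := flip_tr (ptranspose2 (L (ptranspose2 X))).

Lemma flip_linear a X Y : H (a *: X + Y) = a * H X + H Y.
Proof.
rewrite /H ptranspose2_linear lL ptranspose2_linear /flip_tr mulr_sumr -big_split.
by apply: eq_bigr => p _ /=; rewrite entryD entryZ.
Qed.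

Lemma tr_ptranspose2 I1 J1 (X : op R (I1 * J1)) : \tr (ptranspose2 X) = \tr X.
Proof. by rewrite !mxtrace_entry; apply: eq_bigr => -[i j] _; rewrite entry_opmx. Qed.

(** Polarisation: the upper bound at x + y and the lower bound at x - y are added, which cancels the
    diagonal terms H(xx) and H(yy). *)
Lemma flip_polar x y :
  H (outer x y) + H (outer y x) <= \tr (outer x x) + \tr (outer y y).
Proof.
have bnd w (b : bool) : (-1) ^+ b * H (outer w w) <= \tr (outer w w).
  have [_ _ h _] := posL.
  by apply: le_trans (flip_tr_bound b (h w)) _; rewrite tr_ptranspose2 trL tr_ptranspose2.
have lt a (X Y : op R (A * B)) : \tr (a *: X + Y) = a * \tr X + \tr Y.
  by rewrite mxtraceD mxtraceZ.
have h1 := bnd (fun p => real_complex R 1 * x p + real_complex R 1 * y p) false.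
have h2 := bnd (fun p => real_complex R 1 * x p + real_complex R (-1) * y p) true.
rewrite !(form_outer2 flip_linear) !(form_outer2 lt) in h1 h2.
move: (lerD h1 h2); rewrite !rmorphXn !rmorphM !rmorphN !rmorph1 /= -subr_ge0 => h.
rewrite -subr_ge0 -(@pmulr_rge0 _ 2) ?ltr0n//; apply: le_trans h _.
rewrite le_eqVlt; apply/orP; left; apply/eqP; ring.
Qed.

Let g i p : C := e i p.1 * f i p.2.

(** |g_i><g_j| is the partial transpose of |h_ij><h_ji|, where h_ij is e_i tensor the conjugate of
    f_j, a unit vector. Passing from overlap to swap supplies the factor 1/k. *)
Lemma overlap_pair i j : s i != 0 -> s j != 0 ->
  overlap (L (outer (g i) (g j))) + overlap (L (outer (g j) (g i))) <= 2 / k%:R.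
Proof.
move=> si sj.
pose h i j (p : A * B) : C := e i p.1 * (f j p.2)^*.
have eh i' j' : outer (g i') (g j') = ptranspose2 (outer (h i' j') (h j' i')).
  by apply: opP => p q; rewrite !entry_opmx /g /h/= !rmorphM/= conjCK; ring.
have tr_h i' j' : s j' != 0 -> \tr (outer (h i' j') (h i' j')) = 1.
  move=> sj'; rewrite mxtrace_entry sum_pair.
  transitivity ((\sum_a (e i' a)^* * e i' a) * (\sum_b (f j' b)^* * f j' b)).
    rewrite mulr_suml; apply: eq_bigr => a _; rewrite mulr_sumr; apply: eq_bigr => b _.
    by rewrite entry_opmx /h rmorphM/= conjCK; ring.
  by rewrite (schmidt_orthoA sch) (schmidt_orthoB sch)// !eqxx mulr1.
rewrite !overlap_flip_tr !eh -mulrDr mulrC ler_pM2r ?invr_gt0 ?ltr0n//.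
have -> : 2 = \tr (outer (h i j) (h i j)) + \tr (outer (h j i) (h j i)) by rewrite !tr_h.
exact: flip_polar.
Qed.

Let w (P : pred I) p : C := \sum_(i | P i) real_complex R (s i) * g i p.

Lemma tr_outer_partial P :
  \tr (outer (w P) (w P)) = real_complex R (\sum_(i | P i) s i ^+ 2).
Proof.
have lt a (X Y : op R (A * B)) : \tr (a *: X + Y) = a * \tr X + \tr Y.
  by rewrite mxtraceD mxtraceZ.
rewrite (form_outer_sum lt) rmorph_sum/=; apply: eq_bigr => i Pi.
rewrite (bigD1 i)//= big1 ?addr0 => [|j /andP[Pj ij]].
  have [->|si] := eqVneq (s i) 0; first by rewrite rmorph0 !mul0r expr0n.
  rewrite conjC_real_complex -expr2 -rmorphXn/= -[RHS]mulr1; congr (_ * _).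
  rewrite mxtrace_entry sum_pair.
  transitivity ((\sum_a (e i a)^* * e i a) * (\sum_b (f i b)^* * f i b)).
    rewrite mulr_suml; apply: eq_bigr => a _; rewrite mulr_sumr; apply: eq_bigr => b _.
    by rewrite entry_opmx /g rmorphM/=; ring.
  by rewrite (schmidt_orthoA sch) (schmidt_orthoB sch)// !eqxx mulr1.
rewrite mxtrace_entry sum_pair.
rewrite (_ : \sum_a _ = 0) ?mulr0//.
transitivity ((\sum_a (e j a)^* * e i a) * (\sum_b (f j b)^* * f i b)).
  rewrite mulr_suml; apply: eq_bigr => a _; rewrite mulr_sumr; apply: eq_bigr => b _.
  by rewrite entry_opmx /g rmorphM/=; ring.
by rewrite (schmidt_orthoA sch) (negPf ij) mul0r.
Qed.

Lemma overlap_partial_le (P : pred I) :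
  0 <= overlap (L (outer (w P) (w P))) <= real_complex R (\sum_(i | P i) s i ^+ 2).
Proof.
have [_ h _ _] := posL; have pw := h _ (psd_outer (w P)).
by rewrite overlap_ge0//= -tr_outer_partial -trL overlap_le_tr.
Qed.

Lemma overlap_partial_le_inv (P : pred I) : (forall i, P i -> s i != 0) ->
  overlap (L (outer (w P) (w P))) <= real_complex R ((\sum_(i | P i) s i) ^+ 2 / k%:R).
Proof.
move=> Ps; rewrite (form_outer_sum overlap_linear).
pose Q i j := overlap (L (outer (g i) (g j))).
set S := \sum_(i | P i) _.
(* [overlap_pair] bounds only the symmetrised pair, so the double sum is doubled and symmetrised
   first. *)
have eS : 2 * S = \sum_(i | P i) \sum_(j | P j) real_complex R (s i * s j) * (Q i j + Q j i).
  have e1 : S = \sum_(i | P i) \sum_(j | P j) real_complex R (s i * s j) * Q i j.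
    by apply: eq_bigr => i _; apply: eq_bigr => j _; rewrite conjC_real_complex rmorphM.
  rewrite mulr2n mulrDl mul1r {1}e1 e1 [X in _ + X]exchange_big -big_split.
  apply: eq_bigr => i _ /=; rewrite -big_split; apply: eq_bigr => j _ /=.
  by rewrite [s j * s i]mulrC mulrDr.
rewrite -(@ler_pM2l _ 2) ?ltr0n// eS.
have -> : 2 * real_complex R ((\sum_(i | P i) s i) ^+ 2 / k%:R) =
    \sum_(i | P i) \sum_(j | P j) real_complex R (s i * s j) * (2 / k%:R).
  rewrite expr2 mulr_suml !rmorphM/= rmorph_sum/= mulr_suml mulr_sumr; apply: eq_bigr => i _.
  rewrite mulr_sumr rmorph_sum/= fmorphV/= rmorph_nat mulr_suml mulr_sumr.
  by apply: eq_bigr => j _; ring.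
apply: ler_sum => i Pi; apply: ler_sum => j Pj.
rewrite ler_wpM2l ?ler0c ?mulr_ge0 ?(schmidt_ge0 sch)//.
by apply: overlap_pair; exact: Ps.
Qed.

(** Let U, V be the overlaps of the parts below and above [t]. Positivity at c w_P - w_N bounds the
    cross terms by c U + V / c; then U is at most the weight of its part and V at most 1/(kt). *)
Lemma overlap_converse (t c : R) : 0 < t -> 0 < c ->
  overlap (L (outer psi psi)) <=
  real_complex R ((1 + c) * (\sum_(i | s i ^+ 2 < t) s i ^+ 2) + (1 + c^-1) / (k%:R * t)).
Proof.
move=> t0 c0.
pose P := [pred i | s i ^+ 2 < t]; pose N := [pred i | ~~ (s i ^+ 2 < t)].
have k0' : 0 < k%:R :> R by rewrite ltr0n.
have epsi : psi = (fun p => real_complex R 1 * w P p + real_complex R 1 * w N p).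
  by apply/funext => p; rewrite (schmidt_sum sch) (bigID P)/= rmorph1 !mul1r.
rewrite epsi (form_outer2 overlap_linear).
have : 0 <= overlap (L (outer (fun p => real_complex R c * w P p + real_complex R (-1) * w N p)
   (fun p => real_complex R c * w P p + real_complex R (-1) * w N p))).
  by apply: overlap_ge0; have [_ h _ _] := posL; apply/h/psd_outer.
rewrite (form_outer2 overlap_linear).
set X := _ + overlap (L (outer (w N) (w P))).
have /andP[u0 u1] := overlap_partial_le P.
have /andP[v0 _] := overlap_partial_le N.
have sN i : N i -> Num.sqrt t <= s i.
  rewrite /= -leNgt => ti.
  by rewrite -(ger0_norm (schmidt_ge0 sch i)) -sqrtr_sqr ler_wsqrtr.
have st0 : 0 < Num.sqrt t by rewrite sqrtr_gt0.
have v1 : overlap (L (outer (w N) (w N))) <= real_complex R ((k%:R * t)^-1).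
  apply: le_trans (overlap_partial_le_inv _) _ => [i /sN si|].
    by rewrite gt_eqF// (lt_le_trans st0).
  rewrite lecR invfM mulrC ler_wpM2l ?invr_ge0 ?(ltW k0')//.
  (* On [N] each s_i is at least sqrt t, so s_i <= s_i^2 / sqrt t, and the squares sum to at most
     1. *)
  have h : \sum_(i | N i) s i <= (Num.sqrt t)^-1.
    apply: le_trans (_ : \sum_(i | N i) s i ^+ 2 / Num.sqrt t <= _).
      apply: ler_sum => i /sN si; rewrite ler_pdivlMr// expr2 ler_wpM2l//.
      exact: (schmidt_ge0 sch).
    rewrite -mulr_suml ler_piMl ?invr_ge0 ?(ltW st0)//.
    rewrite -(schmidt_norm sch) [leRHS](bigID N)/= lerDl; apply: sumr_ge0 => i _.
    exact: sqr_ge0.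
  have -> : t^-1 = (Num.sqrt t)^-1 ^+ 2 by rewrite exprVn sqr_sqrtr// ltW.
  rewrite ler_pXn2r ?nnegrE ?invr_ge0 ?(ltW st0)//.
  by apply: sumr_ge0 => i _; exact: (schmidt_ge0 sch).
rewrite -/X in u1 v1 *.
set U := overlap (L (outer (w P) (w P))) in u0 u1 *.
set V := overlap (L (outer (w N) (w N))) in v0 v1 *.
move=> hX.
have rc0 : 0 < real_complex R c by rewrite ltcR.
have hX' : X <= real_complex R c * U + real_complex R c^-1 * V.
  rewrite -(ler_pM2l rc0) -subr_ge0; apply: le_trans hX _.
  rewrite le_eqVlt; apply/orP; left; apply/eqP.
  have e1 : real_complex R c * real_complex R c^-1 = 1.
    by rewrite -rmorphM/= mulfV ?rmorph1// gt_eqF.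
  have -> : real_complex R (c ^+ 2) = real_complex R c * real_complex R c by rewrite -rmorphM.
  have -> : real_complex R (c * -1) = - real_complex R c by rewrite mulrN1 rmorphN.
  have -> : real_complex R ((-1) ^+ 2) = 1 by rewrite sqrrN expr1n rmorph1.
  have -> : real_complex R c * (real_complex R c * U + real_complex R c^-1 * V) =
    real_complex R c * real_complex R c * U + real_complex R c * real_complex R c^-1 * V by ring.
  by rewrite e1; ring.
rewrite expr1n mulr1 rmorph1 !mul1r rmorphD !rmorphM !rmorphD rmorph1.
have cU : (1 + real_complex R c) * U <= (1 + real_complex R c) *
    real_complex R (\sum_(i | s i ^+ 2 < t) s i ^+ 2).
  by rewrite ler_wpM2l ?addr_ge0 ?ler01 ?(ltW rc0).
have cV : (1 + real_complex R c^-1) * V <= (1 + real_complex R c^-1) * real_complex R (k%:R * t)^-1.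
  by rewrite ler_wpM2l ?addr_ge0 ?ler01 ?ler0c ?invr_ge0 ?(ltW c0).
apply: le_trans (lerD cU cV).
have -> : (1 + real_complex R c) * U + (1 + real_complex R c^-1) * V =
   U + (real_complex R c * U + real_complex R c^-1 * V) + V by ring.
by rewrite lerD2r lerD2l.
Qed.

End Bound.
End Converse.

(** * One-way protocols *)

Section Protocols.
Variable R : realType.
Local Notation C := (complex R).
Implicit Types I J A B T S : finType.

Definition kraus T I J (K : T -> J -> I -> C) : superop R I J :=
  fun X => opmx (fun a a' => \sum_t \sum_i \sum_i' K t a i * entry X i i' * (K t a' i')^*).

Lemma kraus_linear T I J (K : T -> J -> I -> C) : linear (kraus K).
Proof.
move=> c X Y; apply: opP => a a'; rewrite entryD entryZ !entry_opmx.
rewrite mulr_sumr -big_split; apply: eq_bigr => t _ /=.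
rewrite mulr_sumr -big_split; apply: eq_bigr => i _ /=.
rewrite mulr_sumr -big_split; apply: eq_bigr => i' _ /=.
by rewrite entryD entryZ; ring.
Qed.

Lemma kraus_cp T I J (K : T -> J -> I -> C) : completely_positive (kraus K).
Proof.
split=> [|k X /psd_spectral[x ->]]; first exact: kraus_linear.
have -> : tens_map idfun (kraus K) (\sum_s outer (x s) (x s)) =
    \sum_s \sum_t outer (fun p => \sum_i K t p.2 i * x s (p.1, i))
                        (fun p => \sum_i K t p.2 i * x s (p.1, i)).
  apply: opP => -[j a] [j' a']; rewrite tens_map_idl; last exact: kraus_linear.
  rewrite entry_opmx entry_sum.
  under [RHS]eq_bigr do rewrite entry_sum.
  rewrite [RHS]exchange_big; apply: eq_bigr => t _ /=.
  under [RHS]eq_bigr do rewrite entry_opmx/= mulr_suml.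
  rewrite [RHS]exchange_big; apply: eq_bigr => i _ /=.
  under [RHS]eq_bigr do rewrite rmorph_sum/= mulr_sumr.
  rewrite [RHS]exchange_big; apply: eq_bigr => i' _ /=.
  rewrite entry_opmx entry_sum mulr_sumr mulr_suml; apply: eq_bigr => s _.
  by rewrite entry_opmx rmorphM/=; ring.
by apply: psd_sum => s _; apply: psd_sum => t _; exact: psd_outer.
Qed.

Lemma kraus_tr T I J (K : T -> J -> I -> C) X :
  (\tr (kraus K X) = \sum_i \sum_i' entry X i i' * \sum_t \sum_a (K t a i')^* * K t a i).
Proof.
rewrite mxtrace_entry; under eq_bigr do rewrite entry_opmx.
rewrite exchange_big/=.
transitivity (\sum_t \sum_i \sum_i' \sum_a entry X i i' * ((K t a i')^* * K t a i)).
  apply: eq_bigr => t _; rewrite exchange_big; apply: eq_bigr => i _ /=.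
  rewrite exchange_big; apply: eq_bigr => i' _ /=.
  by apply: eq_bigr => a _; ring.
rewrite exchange_big; apply: eq_bigr => i _ /=; rewrite exchange_big; apply: eq_bigr => i' _ /=.
by rewrite mulr_sumr; apply: eq_bigr => t _; rewrite mulr_sumr.
Qed.

Lemma kraus_trace_preserving T I J (K : T -> J -> I -> C) X :
  (forall i i', \sum_t \sum_a (K t a i')^* * K t a i = (i == i')%:R) ->
  \tr (kraus K X) = \tr X.
Proof.
move=> hK; rewrite kraus_tr mxtrace_entry; apply: eq_bigr => i _.
rewrite -[RHS](sum_delta i (entry X i)); apply: eq_bigr => i' _.
by rewrite hK mulrC.
Qed.

Lemma kraus_channel T I J (K : T -> J -> I -> C) :
  (forall i i', \sum_t \sum_a (K t a i')^* * K t a i = (i == i')%:R) -> channel (kraus K).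
Proof.
by move=> hK; split=> [|X]; [exact: kraus_cp|exact: kraus_trace_preserving].
Qed.

Lemma entry_kraus_ketbra T I J (K : T -> J -> I -> C) p q a a' :
  entry (kraus K (ketbra R p q)) a a' = \sum_t K t a p * (K t a' q)^*.
Proof.
rewrite entry_opmx; apply: eq_bigr => t _.
rewrite -(sum_delta p (fun i => K t a i * (K t a' q)^*)); apply: eq_bigr => i _.
rewrite -(sum_delta q (fun i' => K t a i * (K t a' i')^*)) mulr_sumr; apply: eq_bigr => i' _.
by rewrite entry_ketbra (eq_sym p) (eq_sym q); ring.
Qed.

Lemma psd_choi_kraus T I J (K : T -> J -> I -> C) : psd (choi (kraus K)).
Proof.
have -> : choi (kraus K) = \sum_t outer (fun p => K t p.2 p.1) (fun p => K t p.2 p.1).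
  apply: opP => -[p a] [q b]; rewrite entry_choi entry_kraus_ketbra entry_sum.
  by apply: eq_bigr => t _; rewrite entry_opmx.
by apply: psd_sum => t _; exact: psd_outer.
Qed.

Lemma kraus_outer T I J (K : T -> J -> I -> C) x :
  kraus K (outer x x) = \sum_t outer (fun a => \sum_i K t a i * x i) (fun a => \sum_i K t a i * x i).
Proof.
apply: opP => a a'; rewrite entry_opmx entry_sum; apply: eq_bigr => t _.
rewrite entry_opmx mulr_suml; apply: eq_bigr => i _.
rewrite rmorph_sum/= mulr_sumr; apply: eq_bigr => i' _.
by rewrite entry_opmx rmorphM/=; ring.
Qed.

Section OneWay.
Variables (A B A' B' T S : finType) (U : T -> A' -> A -> C) (W : T -> S -> B' -> B -> C).
Hypothesis UU : forall a1 a2, \sum_x \sum_c (U x c a2)^* * U x c a1 = (a1 == a2)%:R.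
Hypothesis WW : forall x b1 b2, \sum_s \sum_c (W x s c b2)^* * W x s c b1 = (b1 == b2)%:R.

(** Alice has a single Kraus operator per outcome, Bob a family [W x] of them; this explicit form
    gives membership in all four classes. *)
Definition one_way : superop R (A * B) (A' * B') := fun rho =>
  \sum_x tens_map (kraus (fun _ : unit => U x)) (kraus (W x)) rho.

Lemma one_way_kraus rho : one_way rho =
  kraus (fun (y : T * S) (c : A' * B') (p : A * B) => U y.1 c.1 p.1 * W y.1 y.2 c.2 p.2) rho.
Proof.
apply: opP => u v; rewrite entry_sum entry_opmx sum_pair; apply: eq_bigr => x _.
rewrite entry_tens_map [RHS]exchange_big; apply: eq_bigr => p _ /=.
rewrite [RHS]exchange_big; apply: eq_bigr => q _ /=.
rewrite !entry_kraus_ketbra sum_unit !mulr_sumr; apply: eq_bigr => s _.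
by rewrite rmorphM/=; ring.
Qed.

Lemma one_way_channel : channel one_way.
Proof.
have -> : one_way = kraus (fun (y : T * S) (c : A' * B') (p : A * B) => U y.1 c.1 p.1 * W y.1 y.2 c.2 p.2).
  by apply/funext => rho; exact: one_way_kraus.
apply: kraus_channel => -[a1 b1] [a2 b2]; rewrite sum_pair.
transitivity (\sum_x \sum_c (U x c a2)^* * U x c a1 * (b1 == b2)%:R).
  apply: eq_bigr => x _; rewrite -(WW x).
  transitivity (\sum_s \sum_c \sum_d ((U x c a2)^* * U x c a1) * ((W x s d b2)^* * W x s d b1)).
    apply: eq_bigr => s _; rewrite sum_pair; apply: eq_bigr => c _; apply: eq_bigr => d _ /=.
    by rewrite rmorphM/=; ring.
  rewrite exchange_big; apply: eq_bigr => c _ /=; rewrite mulr_sumr.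
  by apply: eq_bigr => s _; rewrite mulr_sumr.
under eq_bigr do rewrite -mulr_suml.
by rewrite -mulr_suml UU -natrM mulnb xpair_eqE.
Qed.

Lemma tens_map_ketbra I J I' J' (f : superop R I I') (g : superop R J J') p q :
  tens_map f g (ketbra R p q) = tens (f (ketbra R p.1 q.1)) (g (ketbra R p.2 q.2)).
Proof.
rewrite /tens_map (bigD1 p)//= (bigD1 q)//= entry_ketbra !eqxx mulr1 scale1r.
rewrite !big1 ?addr0// => [i /negPf ip|i /negPf ip].
  by rewrite big1// => j _; rewrite entry_ketbra ip mul0r scale0r.
by rewrite entry_ketbra ip mulr0 scale0r.
Qed.

Lemma one_way_SEP : T -> SEP_map one_way.
Proof.
move=> x0; split; first exact: one_way_channel.
have T0 : (0 < #|T|)%N by apply/card_gt0P; exists x0.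
have T0' : #|T|%:R != 0 :> R by rewrite pnatr_eq0 -lt0n.
(* A convex combination is required, whereas the Choi matrix is a plain sum over outcomes: uniform
   weights are used and the cardinality is absorbed in Alice's factor. *)
exists #|T|, (fun=> (#|T|%:R)^-1),
  (fun t => real_complex R #|T|%:R *: choi (kraus (fun _ : unit => U (enum_val t)))),
  (fun t => choi (kraus (W (enum_val t)))); split.
- by move=> t; rewrite invr_ge0.
- by rewrite sumr_const card_ord -[LHS]mulr_natr mulVf.
- by move=> t; split; [apply: psdZ => //; exact: psd_choi_kraus|exact: psd_choi_kraus].
apply: opP => -[[a a'] [b b']] [[c c'] [d d']].
rewrite entry_opmx entry_choi/= !entry_sum (reindex (@enum_val T predT))/=; last first.
  by exists enum_rank => x _; rewrite ?enum_rankK ?enum_valK.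
have e1 : real_complex R (#|T|%:R^-1) * real_complex R #|T|%:R = 1.
  by rewrite -rmorphM/= mulVf ?rmorph1.
apply: eq_bigr => t _; rewrite tens_map_ketbra/= entryZ !entry_tens entryZ !entry_choi.
by rewrite -mulrA [RHS]mulrA e1 mul1r.
Qed.

Lemma one_way_one_way_LOCC : one_way_LOCC one_way.
Proof.
exists T, (fun x => kraus (fun _ : unit => U x)), (fun x => kraus (W x)); split => //.
  split=> [x|rho]; first exact: kraus_cp.
  under eq_bigr do rewrite kraus_tr.
  rewrite exchange_big mxtrace_entry; apply: eq_bigr => i _ /=.
  rewrite -[RHS](sum_delta i (entry rho i)) exchange_big; apply: eq_bigr => i' _ /=.
  rewrite -UU mulr_suml; apply: eq_bigr => x _.
  by rewrite sum_unit mulrC.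
by move=> x; exact: kraus_channel.
Qed.

End OneWay.

Lemma one_way_in_class (Omega : op_class) A B A' B' T S U W :
  (forall a1 a2, \sum_x \sum_c (U x c a2)^* * U x c a1 = (a1 == a2)%:R) ->
  (forall x b1 b2, \sum_s \sum_c (W x s c b2)^* * W x s c b1 = (b1 == b2)%:R) ->
  T -> in_class Omega (@one_way A B A' B' T S U W).
Proof.
move=> UU WW x0; case: Omega => /=.
- exact: one_way_one_way_LOCC.
- by apply: one_way_LOCC_LOCC; exact: one_way_one_way_LOCC.
- exact: one_way_SEP.
- by apply: SEP_PPT; exact: one_way_SEP.
Qed.

Lemma in_class_ppt_positive (Omega : op_class) A B A' B' (L : superop R (A * B) (A' * B')) :
  in_class Omega L -> ppt_positive L.
Proof.
case: Omega => /=.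
- by move/one_way_LOCC_LOCC/LOCC_ppt_positive.
- exact: LOCC_ppt_positive.
- by move/SEP_PPT/PPT_ppt_positive.
- exact: PPT_ppt_positive.
Qed.

Section Blocks.
Variables (A B I T : finType) (psi : A * B -> C) (s : I -> R) (e : I -> A -> C) (f : I -> B -> C).
Hypothesis sch : schmidt psi s e f.
Variables (k : nat) (g : I -> T) (pos : I -> 'I_k.+1).
Hypothesis gpos_inj : injective (fun i => (g i, pos i)).

(** By injectivity at most one Schmidt index sits at slot [c] of block [x], so only diagonal terms
    survive. *)
Lemma sum_block (F : I -> I -> C) (P : pred I) x :
  \sum_c \sum_(i | [&& P i, g i == x & pos i == c]) \sum_(j | [&& P j, g j == x & pos j == c]) F i j =
  \sum_(i | P i && (g i == x)) F i i.
Proof.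
rewrite [RHS](partition_big pos predT)//=; apply: eq_bigr => c _.
rewrite [RHS](eq_bigl (fun i => [&& P i, g i == x & pos i == c])); last by move=> i; rewrite andbA.
apply: eq_bigr => i /and3P[Pi /eqP gi /eqP ci]; apply: big_pred1 => j.
apply/and3P/eqP => [[_ /eqP gj /eqP cj]|->]; last by rewrite Pi gi ci !eqxx.
by apply: gpos_inj; rewrite gi gj ci cj.
Qed.

(** Matrix entries of the operator that sends e_i to |pos i> for i in block [x] and kills the other
    e_i. [predT i] gives the index set the shape of [sum_block]. *)
Definition alice (x : T) (c : 'I_k.+1) (a : A) : C :=
  \sum_(i | [&& predT i, g i == x & pos i == c]) (e i a)^*.

Definition bob_block (x : T) (c : 'I_k.+1) (b : B) : C :=
  \sum_(i | [&& s i != 0, g i == x & pos i == c]) (f i b)^*.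

(** The projector onto the f_i of block [x], restricted to s_i != 0, where the f_i are
    orthonormal. *)
Definition bob_proj (x : T) (b b' : B) : C :=
  \sum_(i | (s i != 0) && (g i == x)) f i b * (f i b')^*.

(* [Some b] stands for preparing |0> after the outcome |b> outside the block. *)
Definition bob (x : T) (o : option B) (c : 'I_k.+1) (b : B) : C :=
  if o is Some b0 then (c == ord0)%:R * ((b0 == b)%:R - bob_proj x b0 b)
  else bob_block x c b.

Lemma alice_complete a1 a2 :
  \sum_x \sum_c (alice x c a2)^* * alice x c a1 = (a1 == a2)%:R.
Proof.
rewrite eq_sym -(schmidt_basisA sch) (partition_big g predT)//=; apply: eq_bigr => x _.
rewrite -(sum_block (fun i j => e i a2 * (e j a1)^*) predT x); apply: eq_bigr => c _.
rewrite rmorph_sum/= mulr_suml; apply: eq_bigr => i _.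
by rewrite conjCK mulr_sumr.
Qed.

Lemma bob_proj_conj x b b' : (bob_proj x b b')^* = bob_proj x b' b.
Proof.
by rewrite rmorph_sum/=; apply: eq_bigr => i _; rewrite rmorphM/= conjCK mulrC.
Qed.

Lemma bob_proj_idem x b b' : \sum_c bob_proj x b c * bob_proj x c b' = bob_proj x b b'.
Proof.
transitivity (\sum_(i | (s i != 0) && (g i == x)) \sum_(j | (s j != 0) && (g j == x))
    f i b * (f j b')^* * \sum_c (f i c)^* * f j c).
  rewrite (eq_bigr (fun c => \sum_(i | (s i != 0) && (g i == x)) \sum_(j | (s j != 0) && (g j == x))
    f i b * (f j b')^* * ((f i c)^* * f j c))).
    rewrite exchange_big; apply: eq_bigr => i _ /=; rewrite exchange_big; apply: eq_bigr => j _ /=.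
    by rewrite mulr_sumr.
  move=> c _; rewrite mulr_suml; apply: eq_bigr => i _; rewrite mulr_sumr; apply: eq_bigr => j _.
  by ring.
apply: eq_bigr => i /andP[si gi]; rewrite (bigD1 i) ?si ?gi//=.
rewrite (schmidt_orthoB sch)// eqxx mulr1 big1 ?addr0// => j /andP[/andP[sj _] /negPf ji].
by rewrite (schmidt_orthoB sch)// eq_sym ji mulr0.
Qed.

Lemma sum_option (X : finType) (F : option X -> C) : \sum_o F o = F None + \sum_x F (Some x).
Proof.
rewrite (bigD1 None)//=; congr (_ + _).
rewrite (reindex_omap Some id) /=; last by case.
by apply: eq_bigl => x; rewrite eqxx.
Qed.

(** With P the projector [bob_proj x], this is P + (1 - P)^2 = 1. *)
Lemma bob_complete x b1 b2 :
  \sum_o \sum_c (bob x o c b2)^* * bob x o c b1 = (b1 == b2)%:R.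
Proof.
have hc (a a' : nat) (z : C) : (a%:R * (a'%:R - z))^* = a%:R * (a'%:R - z^*).
  by rewrite rmorphM rmorphB/= !conjC_nat.
rewrite sum_option /=.
have -> : \sum_c (bob_block x c b2)^* * bob_block x c b1 = bob_proj x b2 b1.
  rewrite /bob_proj -(sum_block (fun i j => f i b2 * (f j b1)^*) (fun i => s i != 0) x).
  apply: eq_bigr => c _; rewrite rmorph_sum/= mulr_suml; apply: eq_bigr => i _.
  by rewrite conjCK mulr_sumr.
have -> : \sum_b \sum_c ((c == ord0)%:R * ((b == b2)%:R - bob_proj x b b2))^* *
    ((c == ord0 :> 'I_k.+1)%:R * ((b == b1)%:R - bob_proj x b b1)) =
    \sum_b ((b2 == b)%:R * ((b1 == b)%:R - bob_proj x b b1)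
      - (b1 == b)%:R * bob_proj x b2 b + bob_proj x b2 b * bob_proj x b b1).
  apply: eq_bigr => b _.
  pose z1 : C := (b == b2)%:R - bob_proj x b2 b.
  pose z2 : C := (b == b1)%:R - bob_proj x b b1.
  transitivity (z1 * z2); last by rewrite /z1 /z2 !(eq_sym _ b); ring.
  rewrite -[RHS](sum_delta (ord0 : 'I_k.+1) (fun=> z1 * z2)); apply: eq_bigr => c _.
  rewrite hc bob_proj_conj (eq_sym ord0) -/z1 -/z2.
  by case: (c == ord0); rewrite ?mulr1n ?mulr0n; ring.
rewrite big_split/= sumrB bob_proj_idem !sum_delta; ring.
Qed.

(** Outcome (x, None) leaves the unnormalised vector with amplitude s_i at |pos i>|pos i> for i in
    block x, whose overlap is the square of the sum of these s_i over the dimension. The outcomes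
    [Some b] contribute nonnegatively and are dropped. *)
Lemma block_protocol (Omega : op_class) : T ->
  exists2 L : superop R (A * B) ('I_k.+1 * 'I_k.+1), in_class Omega L &
    real_complex R (k.+1%:R^-1 * \sum_x (\sum_(i | g i == x) s i) ^+ 2) <=
    overlap (L (outer psi psi)).
Proof.
move=> x0; exists (one_way alice bob).
  by apply: one_way_in_class => //; [exact: alice_complete|exact: bob_complete].
rewrite one_way_kraus kraus_outer.
pose K (y : T * option B) (c : 'I_k.+1 * 'I_k.+1) (p : A * B) : C :=
  alice y.1 c.1 p.1 * bob y.1 y.2 c.2 p.2.
rewrite -/K.
pose v y := outer (fun a => \sum_i K y a i * psi i) (fun a => \sum_i K y a i * psi i).
rewrite -[X in overlap X]/(\sum_t v t).
have -> : overlap (\sum_t v t) = \sum_t overlap (v t).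
  rewrite /overlap -mulr_sumr; congr (_ * _); rewrite [RHS]exchange_big; apply: eq_bigr => i _ /=.
  rewrite [RHS]exchange_big; apply: eq_bigr => j _ /=; by rewrite entry_sum.
rewrite sum_pair rmorphM/= rmorph_sum/= mulr_sumr; apply: ler_sum => x _.
rewrite sum_option -[leLHS]addr0; apply: lerD; last first.
  by apply: sumr_ge0 => b _; apply: overlap_ge0; exact: psd_outer.
rewrite le_eqVlt; apply/orP; left; apply/eqP.
have hK c : \sum_p K (x, None) (c, c) p * psi p =
    real_complex R (\sum_(i | (g i == x) && (pos i == c)) s i).
  transitivity (\sum_i real_complex R (s i) * ((\sum_a alice x c a * e i a) *
     (\sum_b bob_block x c b * f i b))).
    rewrite sum_pair.
    rewrite (eq_bigr (fun a => \sum_i \sum_b real_complex R (s i) *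
       ((alice x c a * e i a) * (bob_block x c b * f i b)))).
      rewrite exchange_big; apply: eq_bigr => i _ /=.
      rewrite mulr_suml mulr_sumr; apply: eq_bigr => a _.
      by rewrite mulr_sumr mulr_sumr.
    move=> a _; rewrite exchange_big; apply: eq_bigr => b _ /=.
    rewrite (schmidt_sum sch) mulr_sumr; apply: eq_bigr => i _ /=.
    by rewrite /K/=; ring.
  have ha i : \sum_a alice x c a * e i a = ((g i == x) && (pos i == c))%:R.
    rewrite (eq_bigr (fun a => \sum_(j | (g j == x) && (pos j == c)) (e j a)^* * e i a)).
      rewrite exchange_big /= (eq_bigr (fun j => (j == i)%:R)); last first.
        by move=> j _; rewrite (schmidt_orthoA sch).
      case: (boolP ((g i == x) && (pos i == c))) => hi.
        rewrite (bigD1 i)//= eqxx big1 ?addr0// => j /andP[_ /negPf ->]; exact: erefl.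
      rewrite big1// => j hj; case: eqP => // ji; by rewrite -ji hj in hi.
    by move=> a _; rewrite mulr_suml.
  have hb i : s i != 0 -> \sum_b bob_block x c b * f i b = ((g i == x) && (pos i == c))%:R.
    move=> si.
    rewrite (eq_bigr (fun b => \sum_(j | [&& s j != 0, g j == x & pos j == c]) (f j b)^* * f i b)).
      rewrite exchange_big /= (eq_bigr (fun j => (j == i)%:R)); last first.
        by move=> j /and3P[sj _ _]; rewrite (schmidt_orthoB sch).
      case: (boolP ((g i == x) && (pos i == c))) => hi.
        rewrite (bigD1 i) ?si//= eqxx big1 ?addr0// => j /andP[_ /negPf ->]; exact: erefl.
      rewrite big1// => j /andP[_ hj]; case: eqP => // ji; by rewrite -ji hj in hi.
    by move=> b _; rewrite mulr_suml.
  rewrite rmorph_sum/= [RHS]big_mkcond; apply: eq_bigr => i _.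
  have [->|si] := eqVneq (s i) 0; first by rewrite rmorph0 mul0r; case: ifP.
  by rewrite ha hb//; case: ifP; rewrite ?mulr1n ?mulr0n ?mulr1 ?mulr0 ?mul0r.
rewrite /overlap fmorphV/= rmorph_nat; congr (_ * _).
have -> : \sum_(i | g i == x) s i = \sum_c \sum_(i | (g i == x) && (pos i == c)) s i.
  by rewrite (partition_big pos predT).
rewrite expr2 mulr_suml rmorph_sum/=; apply: eq_bigr => c _.
rewrite mulr_sumr rmorph_sum/=; apply: eq_bigr => d _.
by rewrite entry_opmx !hK conjC_real_complex rmorphM.
Qed.

End Blocks.
End Protocols.

(** * Blocks of equal Schmidt coefficients *)

Section BlockCount.
Variables (R : realType) (I T : finType) (cl : I -> T) (s : I -> R) (q : T -> R) (k : nat).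
Hypotheses (s0 : forall i, 0 <= s i) (q0 : forall x, 0 <= q x).
Hypothesis sq : forall i, s i ^+ 2 = q (cl i).
Hypothesis s1 : \sum_i s i ^+ 2 = 1.

Let class x : pred I := [pred i | cl i == x].
Let rank i := index i (enum (class (cl i))).

Lemma rank_lt i : (rank i < #|class (cl i)|)%N.
Proof. by rewrite cardE index_mem mem_enum inE. Qed.

Lemma rank_leq i : (rank i <= #|I|)%N.
Proof. by apply: leq_trans (ltnW (rank_lt i)) _; exact: max_card. Qed.

(** Each class is enumerated and cut into consecutive runs of length [k.+1]. No quotient exceeds
    [#|I|], so [inord] never takes its default value. *)
Definition block (i : I) : T * 'I_#|I|.+1 := (cl i, inord (rank i %/ k.+1)).
Definition slot (i : I) : 'I_k.+1 := inord (rank i %% k.+1).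

Lemma block_slot_inj : injective (fun i => (block i, slot i)).
Proof.
move=> i j [cij].
have bi l : (rank l %/ k.+1 < #|I|.+1)%N by rewrite ltnS (leq_trans (leq_div _ _) (rank_leq l)).
have si l : (rank l %% k.+1 < k.+1)%N by rewrite ltn_mod.
move/(congr1 val); rewrite /= !inordK// => div_ij.
move/(congr1 val); rewrite /= !inordK// => mod_ij.
have rij : rank i = rank j.
  by rewrite (divn_eq (rank i) k.+1) (divn_eq (rank j) k.+1) div_ij mod_ij.
have ii : i \in enum (class (cl i)) by rewrite mem_enum inE.
have jj : j \in enum (class (cl i)) by rewrite mem_enum inE cij.
by rewrite -(nth_index i ii) -(nth_index i jj) -/(rank i) rij /rank cij.
Qed.

(* In a block of m elements of a class of weight q, (m - k)^2 >= 0 gives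
   m^2 q / k >= q (2 m - k). *)
Lemma class_block_ge x t : q x <= t ->
  q x * #|class x|%:R - k.+1%:R * t <=
  k.+1%:R^-1 * \sum_b (\sum_(i | block i == (x, b)) s i) ^+ 2.
Proof.
move=> qt; set d := #|class x|.
have k0 : 0 < k.+1%:R :> R by rewrite ltr0n.
pose m (b : 'I_#|I|.+1) : R := \sum_(i | block i == (x, b)) 1.
have em b : \sum_(i | block i == (x, b)) s i = Num.sqrt (q x) * m b.
  rewrite mulr_sumr; apply: eq_bigr => i /eqP[ci _].
  by rewrite mulr1 -ci -sq sqrtr_sqr ger0_norm.
have dI : (d %/ k.+1 <= #|I|)%N by rewrite (leq_trans (leq_div _ _))// max_card.
(* Every label summed costs [k.+1], so only the labels that can occur are kept; together they cost
   at most d + [k.+1], leaving 2d - (d + [k.+1]). *)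
have md : \sum_(b < #|I|.+1 | (b <= d %/ k.+1)%N) m b = d%:R.
  have -> : d%:R = \sum_(i in class x) 1 :> R by rewrite /d -sum1_card natr_sum.
  rewrite [RHS](partition_big (fun i => (block i).2) (fun b => (b <= d %/ k.+1)%N))/=; last first.
    move=> i /eqP ci; rewrite inordK.
      by rewrite leq_div2r// ltnW// /d -ci rank_lt.
    by rewrite ltnS (leq_trans (leq_div _ _) (rank_leq i)).
  by apply: eq_bigr => b _; apply: eq_bigl => i; rewrite /block xpair_eqE.
have cnt : \sum_(b < #|I|.+1 | (b <= d %/ k.+1)%N) (1 : R) = (d %/ k.+1).+1%:R.
  by rewrite (big_ord_narrow_leq dI) sumr_const card_ord.
apply: le_trans (_ : \sum_(b < #|I|.+1 | (b <= d %/ k.+1)%N) q x * (2 * m b - k.+1%:R) <= _).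
  rewrite -mulr_sumr sumrB -mulr_sumr md.
  have -> : \sum_(b < #|I|.+1 | (b <= d %/ k.+1)%N) k.+1%:R = k.+1%:R * (d %/ k.+1).+1%:R :> R.
    by rewrite -cnt mulr_sumr; apply: eq_bigr => b _; rewrite mulr1.
  have h : k.+1%:R * (d %/ k.+1).+1%:R <= d%:R + k.+1%:R :> R.
    by rewrite -natrM -natrD ler_nat mulnS addnC leq_add2r mulnC leq_divM.
  have := ler_wpM2l (q0 x) h; have := ler_wpM2l (ltW k0) qt; lra.
rewrite mulr_sumr [leRHS](bigID (fun b : 'I_#|I|.+1 => (b <= d %/ k.+1)%N))/= -[leLHS]addr0.
apply: lerD; last by apply: sumr_ge0 => b _; rewrite mulr_ge0 ?sqr_ge0 ?invr_ge0.
apply: ler_sum => b _; rewrite em exprMn sqr_sqrtr// mulrCA ler_wpM2l//.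
rewrite [leRHS]mulrC ler_pdivlMr//; have := sqr_ge0 (m b - k.+1%:R); lra.
Qed.

(** The classes with q <= t carry all the weight outside the tail, and each of the at most [#|T|]
    classes loses [k.+1%:R * t] to its incomplete block. *)
Lemma block_sum_ge t : 0 <= t ->
  1 - \sum_(i | t < s i ^+ 2) s i ^+ 2 - #|T|%:R * (k.+1%:R * t) <=
  k.+1%:R^-1 * \sum_x (\sum_(i | block i == x) s i) ^+ 2.
Proof.
move=> t0; have k0 : 0 < k.+1%:R :> R by rewrite ltr0n.
have -> : \sum_x (\sum_(i | block i == x) s i) ^+ 2 =
    \sum_x \sum_b (\sum_(i | block i == (x, b)) s i) ^+ 2.
  by rewrite pair_bigA; apply: eq_bigr => -[].
rewrite mulr_sumr.
apply: le_trans (_ : \sum_(x | q x <= t) (q x * #|class x|%:R - k.+1%:R * t) <= _); last first.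
  rewrite [leRHS](bigID (fun x => q x <= t))/= -[leLHS]addr0; apply: lerD.
    by apply: ler_sum => x; exact: class_block_ge.
  by apply: sumr_ge0 => x _; rewrite mulr_ge0 ?invr_ge0// sumr_ge0// => b _; rewrite sqr_ge0.
rewrite sumrB; apply: lerB; last first.
  rewrite sumr_const -[leLHS]mulr_natl ler_wpM2r ?mulr_ge0 ?(ltW k0)//.
  by rewrite ler_nat max_card.
have -> : 1 - \sum_(i | t < s i ^+ 2) s i ^+ 2 = \sum_(i | ~~ (t < s i ^+ 2)) s i ^+ 2.
  by rewrite -[X in X - _]s1 (bigID (fun i => t < s i ^+ 2))/= addrAC subrr add0r.
rewrite (partition_big cl (fun x => q x <= t)) => [/=|i]; last by rewrite -leNgt sq.
rewrite le_eqVlt; apply/orP; left; apply/eqP; apply: eq_bigr => x qx.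
have -> : #|class x|%:R = \sum_(i in class x) 1 :> R by rewrite -sum1_card natr_sum.
rewrite mulr_sumr; apply: eq_big => i; rewrite ?inE.
  by case: eqP => [ci|]; rewrite ?andbF// andbT -leNgt sq ci.
by move=> /andP[_ /eqP ci]; rewrite sq ci mulr1.
Qed.

End BlockCount.

Section Types.
Variables (R : realType) (K : finType) (p : K -> R) (n : nat).

(** The type of a sequence in the method of types: how often each letter occurs. *)
Definition type_class (i : {ffun 'I_n -> K}) : {ffun K -> 'I_n.+1} :=
  [ffun x => inord #|[pred k | i k == x]|].

Lemma prod_type_class (i : {ffun 'I_n -> K}) :
  \prod_k p (i k) = \prod_x p x ^+ type_class i x.
Proof.
rewrite (partition_big i predT)//=; apply: eq_bigr => x _.
rewrite ffunE inordK; last by rewrite ltnS (leq_trans (max_card _))// card_ord.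
by rewrite (eq_bigr (fun=> p x)) ?prodr_const// => k /eqP ->.
Qed.

Lemma card_type_class : #|{ffun K -> 'I_n.+1}| = (n.+1 ^ #|K|)%N.
Proof. by rewrite card_ffun card_ord. Qed.

End Types.

(** * Schmidt decomposition of tensor powers *)

Section SchmidtDecomposition.
Variable R : realType.
Local Notation C := (complex R).
Implicit Types A B I : finType.

Definition ket_tpow A B (n : nat) (psi : A * B -> C)
    (q : {ffun 'I_n -> A} * {ffun 'I_n -> B}) : C :=
  \prod_k psi (q.1 k, q.2 k).
Arguments ket_tpow {A B} n psi q.

Lemma schmidt_tpow A B I (psi : A * B -> C) (s : I -> R) (e : I -> A -> C) (f : I -> B -> C) n :
  schmidt psi s e f ->
  schmidt (ket_tpow n psi)
    (fun i : {ffun 'I_n -> I} => \prod_k s (i k))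
    (fun i a => \prod_k e (i k) (a k)) (fun i b => \prod_k f (i k) (b k)).
Proof.
move=> sch; split.
- move=> [a b]; rewrite /ket_tpow /=.
  rewrite (eq_bigr (fun k => \sum_i real_complex R (s i) * (e i (a k) * f i (b k)))); last first.
    by move=> k _; rewrite (schmidt_sum sch).
  rewrite bigA_distr_bigA/=; apply: eq_bigr => i _.
  by rewrite !big_split/= rmorph_prod.
- by move=> i; apply: prodr_ge0 => k _; exact: (schmidt_ge0 sch).
- rewrite (eq_bigr (fun i : {ffun 'I_n -> I} => \prod_k s (i k) ^+ 2)); last first.
    by move=> i _; rewrite prodrXl.
  rewrite -(bigA_distr_bigA (fun _ x => s x ^+ 2))/= (eq_bigr (fun=> 1)) ?big1_eq//.
  by move=> k _; rewrite (schmidt_norm sch).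
- move=> i j.
  rewrite (eq_bigr (fun a : {ffun 'I_n -> A} => \prod_k ((e (i k) (a k))^* * e (j k) (a k)))).
    rewrite -(bigA_distr_bigA (fun k x => (e (i k) x)^* * e (j k) x))/=.
    rewrite (eq_bigr (fun k => (i k == j k)%:R)); last by move=> k _; rewrite (schmidt_orthoA sch).
    have [->|ij] := eqVneq i j; first by rewrite big1// => k _; rewrite eqxx.
    have [k ijk] : exists k, i k != j k.
      apply/existsP; apply: contraR ij; rewrite negb_exists => /forallP h.
      by apply/eqP/ffunP => k; apply/eqP; have := h k; rewrite negbK.
    by rewrite (bigD1 k)//= (negPf ijk) mul0r.
  by move=> a _; rewrite rmorph_prod/= big_split.
- move=> a a'.
  rewrite (eq_bigr (fun i : {ffun 'I_n -> I} => \prod_k (e (i k) (a k) * (e (i k) (a' k))^*))).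
    rewrite -(bigA_distr_bigA (fun k x => e x (a k) * (e x (a' k))^*))/=.
    rewrite (eq_bigr (fun k => (a k == a' k)%:R)); last by move=> k _; rewrite (schmidt_basisA sch).
    have [->|ij] := eqVneq a a'; first by rewrite big1// => k _; rewrite eqxx.
    have [k ijk] : exists k, a k != a' k.
      apply/existsP; apply: contraR ij; rewrite negb_exists => /forallP h.
      by apply/eqP/ffunP => k; apply/eqP; have := h k; rewrite negbK.
    by rewrite (bigD1 k)//= (negPf ijk) mul0r.
  by move=> i _; rewrite rmorph_prod/= big_split.
- move=> i j /prodf_neq0 si /prodf_neq0 sj.
  rewrite (eq_bigr (fun b : {ffun 'I_n -> B} => \prod_k ((f (i k) (b k))^* * f (j k) (b k)))).
    rewrite -(bigA_distr_bigA (fun k x => (f (i k) x)^* * f (j k) x))/=.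
    rewrite (eq_bigr (fun k => (i k == j k)%:R)); last first.
      by move=> k _; rewrite (schmidt_orthoB sch) ?si ?sj.
    have [->|ij] := eqVneq i j; first by rewrite big1// => k _; rewrite eqxx.
    have [k ijk] : exists k, i k != j k.
      apply/existsP; apply: contraR ij; rewrite negb_exists => /forallP h.
      by apply/eqP/ffunP => k; apply/eqP; have := h k; rewrite negbK.
    by rewrite (bigD1 k)//= (negPf ijk) mul0r.
  by move=> a _; rewrite rmorph_prod/= big_split.
Qed.

Lemma bipartite_tpow_outer A B (psi : A * B -> C) n :
  bipartite_tpow n (outer psi psi) =
  outer (ket_tpow n psi) (ket_tpow n psi).
Proof.
apply: opP => p q; rewrite !entry_opmx rmorph_prod/= -big_split.
by apply: eq_bigr => k _; rewrite entry_opmx.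
Qed.

Section OneCopy.
Variables (A B : finType) (psi : A * B -> C).
Hypothesis psi1 : \sum_p (psi p)^* * psi p = 1.

Let rho := ptrace2 (outer psi psi).
Let P := spectralmx rho.
Let d := spectral_diag rho.

Definition eigenprob (t : 'I_#|A|) : R := complex.Re (d 0 t).

Let psd_rho : psd rho.
Proof.
have -> : rho = \sum_b outer (fun a => psi (a, b)) (fun a => psi (a, b)).
  apply: opP => a a'; rewrite entry_opmx entry_sum.
  by apply: eq_bigr => b _; rewrite !entry_opmx.
by apply: psd_sum => b _; exact: psd_outer.
Qed.

Let rhoE : rho = P^t* *m diag_mx d *m P := (psd_diagonalization psd_rho).1.
Let PP : P *m P^t* = 1%:M. Proof. exact/unitarymxP/spectral_unitarymx. Qed.
Let PP' : P^t* *m P = 1%:M. Proof. by apply: mulmx1C; exact: PP. Qed.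

Let dE t : d 0 t = real_complex R (eigenprob t).
Proof.
have := (psd_diagonalization psd_rho).2 t; rewrite -/rho -/d /eigenprob.
by rewrite lecE => /andP[/eqP/= i0 _]; case: (d 0 t) i0 => x y /= ->.
Qed.

Lemma eigenprob_ge0 t : 0 <= eigenprob t.
Proof. by have := (psd_diagonalization psd_rho).2 t; rewrite -/rho -/d dE ler0c. Qed.

Lemma trace_diag (D : 'rV[C]_#|{: A}|) : \tr (P^t* *m diag_mx D *m P) = \sum_t D 0 t.
Proof.
rewrite -mulmxA mxtrace_mulC -mulmxA PP mulmx1.
by apply: eq_bigr => t _; rewrite mxE eqxx mulr1n.
Qed.

Let tr_rho : \tr rho = 1.
Proof.
rewrite mxtrace_entry -psi1 sum_pair; apply: eq_bigr => a _.
by rewrite entry_opmx; apply: eq_bigr => b _; rewrite entry_opmx mulrC.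
Qed.

Lemma eigenprob_sum : \sum_t eigenprob t = 1.
Proof.
have := tr_rho; rewrite rhoE trace_diag (eq_bigr _ (fun t _ => dE t)) -rmorph_sum/=.
by move/complexI.
Qed.

Definition schmidt_vecA (t : 'I_#|A|) (a : A) : C := (P t (enum_rank a))^*.
(** The t-th eigenvector of [rho], as a bra, applied to Alice's half of [psi]. Its normalisation
    [schmidt_vecB] is 0 at eigenvalue 0, by the convention for division. *)
Definition schmidt_vecB0 (t : 'I_#|A|) (b : B) : C := \sum_a P t (enum_rank a) * psi (a, b).
Definition schmidt_vecB (t : 'I_#|A|) (b : B) : C :=
  schmidt_vecB0 t b / real_complex R (Num.sqrt (eigenprob t)).

(** The Gram matrix of these vectors is, up to transposition, [rho] in its own eigenbasis, hence
    diagonal. *)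
Let vecB0_ortho i j :
  \sum_b (schmidt_vecB0 i b)^* * schmidt_vecB0 j b = (i == j)%:R * d 0 j.
Proof.
have -> : (i == j)%:R * d 0 j = (P *m rho *m P^t*) j i.
  rewrite rhoE !mulmxA PP mul1mx -mulmxA PP mulmx1 mxE.
  by have [_|_] := eqVneq i j; rewrite ?mul1r ?mulr1n ?mul0r ?mulr0n.
rewrite mxE sum_enum_rank.
transitivity (\sum_b \sum_a \sum_a' (P i (enum_rank a))^* * P j (enum_rank a') *
   (psi (a', b) * (psi (a, b))^*)).
  apply: eq_bigr => b _; rewrite rmorph_sum/= mulr_suml; apply: eq_bigr => a _.
  rewrite mulr_sumr; apply: eq_bigr => a' _.
  by rewrite rmorphM/=; ring.
rewrite exchange_big; apply: eq_bigr => a _ /=.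
rewrite !mxE sum_enum_rank mulr_suml exchange_big; apply: eq_bigr => a' _ /=.
rewrite -mulr_sumr -[rho _ _]/(entry rho a' a) entry_opmx.
under [in RHS]eq_bigr do rewrite entry_opmx.
by ring.
Qed.

Lemma schmidt_exists :
  schmidt psi (fun t => Num.sqrt (eigenprob t)) schmidt_vecA schmidt_vecB.
Proof.
have s2 t : Num.sqrt (eigenprob t) ^+ 2 = eigenprob t by rewrite sqr_sqrtr// eigenprob_ge0.
split.
- move=> [a b] /=.
  have sf t : real_complex R (Num.sqrt (eigenprob t)) * (schmidt_vecA t a * schmidt_vecB t b) =
      schmidt_vecA t a * schmidt_vecB0 t b.
    rewrite mulrCA; congr (_ * _); rewrite /schmidt_vecB.
    have [s0|s0] := eqVneq (Num.sqrt (eigenprob t)) 0; last first.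
      by rewrite mulrC divfK// fmorph_eq0.
    (* At eigenvalue 0 the vector itself vanishes, its squared norm being the eigenvalue, so the
       default value 0 of the division loses nothing. *)
    rewrite s0 rmorph0 mul0r; apply/esym/eqP.
    have := vecB0_ortho t t; rewrite dE -s2 s0 expr0n/= rmorph0 mulr0 => /eqP.
    rewrite psumr_eq0 => [/allP/(_ b (mem_index_enum _))|b' _]; last first.
      by rewrite mulrC mul_conjC_ge0.
    by rewrite /= mulf_eq0 conjC_eq0 orbb.
  rewrite (eq_bigr _ (fun t _ => sf t)).
  transitivity (\sum_a' (a == a')%:R * psi (a', b)); first by rewrite sum_delta.
  rewrite /schmidt_vecB0; under [RHS]eq_bigr do rewrite mulr_sumr.
  rewrite exchange_big; apply: eq_bigr => a' _ /=.
  under [RHS]eq_bigr do rewrite mulrA.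
  rewrite -mulr_suml; congr (_ * _).
  have := congr1 (fun M : op R A => entry M a a') PP'.
  rewrite /entry !mxE (inj_eq enum_rank_inj) => <-.
  by apply: eq_bigr => t _; rewrite !mxE.
- by move=> t; exact: sqrtr_ge0.
- by rewrite (eq_bigr _ (fun t _ => s2 t)) eigenprob_sum.
- move=> i j; have := congr1 (fun M : op R A => M i j) PP.
  rewrite !mxE sum_enum_rank => <-.
  by apply: eq_bigr => a _; rewrite !mxE conjCK.
- move=> a a'; have := congr1 (fun M : op R A => entry M a a') PP'.
  rewrite /entry !mxE (inj_eq enum_rank_inj) => <-.
  by apply: eq_bigr => t _; rewrite !mxE conjCK.
- move=> i j si sj; rewrite /schmidt_vecB.
  rewrite (eq_bigr (fun b => (schmidt_vecB0 i b)^* * schmidt_vecB0 j b *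
    ((real_complex R (Num.sqrt (eigenprob i)))^-1 * (real_complex R (Num.sqrt (eigenprob j)))^-1))).
    rewrite -mulr_suml vecB0_ortho; have [<-|ij] := eqVneq i j; last by rewrite !mul0r.
    by rewrite mul1r dE -{1}s2 rmorphXn/= -invfM expr2 mulfV// mulf_neq0// fmorph_eq0.
  by move=> b _; rewrite rmorphM fmorphV/= conjC_real_complex; ring.
Qed.

Let logmE : logm rho = P^t* *m diag_mx (\row_t real_complex R (log2 (eigenprob t))) *m P.
Proof.
have eP : invmx P = P^t* by exact: invmx_unitary (spectral_unitarymx _).
transitivity (invmx P *m diag_mx (map_mx (fun z => real_complex R (log2 (complex.Re z))) d) *m P).
  exact: erefl.
rewrite eP; apply: (congr1 (fun D => P^t* *m diag_mx D *m P)).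
by apply/rowP => t; rewrite !mxE.
Qed.

Let sandwichM (D E : 'rV[C]_#|{: A}|) :
  (P^t* *m diag_mx D *m P) *m (P^t* *m diag_mx E *m P) =
  P^t* *m diag_mx (\row_t (D 0 t * E 0 t)) *m P.
Proof.
rewrite -!mulmxA (mulmxA P) PP mul1mx (mulmxA (diag_mx D)) mulmxA.
rewrite mulmxA; apply: (congr1 (fun M => P^t* *m M *m P)).
by apply/matrixP => i j; rewrite mul_diag_mx !mxE mulrnAr.
Qed.

Lemma entropy_mean :
  entropy rho = mean eigenprob (fun t => - log2 (eigenprob t)).
Proof.
rewrite /entropy logmE {1}rhoE sandwichM trace_diag /mean.
rewrite (eq_bigr (fun t => real_complex R (eigenprob t * log2 (eigenprob t)))); last first.
  by move=> t _; rewrite !mxE dE [RHS]rmorphM.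
rewrite -rmorph_sum/= -sumrN; apply: eq_bigr => t _; by rewrite mulrN.
Qed.

Lemma entropy_variance_variance :
  entropy_variance rho = variance eigenprob (fun t => - log2 (eigenprob t)).
Proof.
rewrite /entropy_variance entropy_mean /variance; congr (_ - _).
rewrite logmE {1}rhoE !sandwichM trace_diag.
rewrite (eq_bigr (fun t => real_complex R (eigenprob t * (log2 (eigenprob t) * log2 (eigenprob t))))); last first.
  by move=> t _; rewrite !mxE dE [RHS]rmorphM [X in _ = _ * X]rmorphM.
by rewrite -rmorph_sum/=; apply: eq_bigr => t _; rewrite sqrrN expr2.
Qed.

End OneCopy.
End SchmidtDecomposition.
Arguments ket_tpow {R A B} n psi q.

(** * Second-order asymptotics *)

Section Assembly.
Variable R : realType.
Local Notation C := (complex R).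

Lemma max_natP (S : set nat) (N : nat) : S 1%N -> (forall k, S k -> (k <= N)%N) ->
  S (max_nat S) /\ forall j, S j -> (j <= max_nat S)%N.
Proof.
move=> S1 SN; apply: (@xgetPex _ 0%N [set k | S k /\ forall j, S j -> (j <= k)%N]).
have ex : exists k, `[< S k >] by exists 1%N; apply/asboolP.
have ub k : `[< S k >] -> (k <= N)%N by move=> /asboolP/SN.
case: (ex_maxnP ex ub) => m /asboolP Sm hm.
by exists m; split => // j Sj; apply: hm; apply/asboolP.
Qed.

(** * Fidelity bounds for a state in Schmidt form *)

Section Fidelity.
Variables (Omega : op_class) (A B I : finType) (psi : A * B -> C).
Variables (s : I -> R) (e : I -> A -> C) (f : I -> B -> C).
Hypothesis sch : schmidt psi s e f.

Lemma schmidt_index : {i : I | s i != 0}.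
Proof.
have : exists i, s i != 0.
  apply/existsP; apply: contra_eqT (schmidt_norm sch); rewrite negb_exists => /forallP h.
  rewrite big1 ?(eq_sym 0) ?oner_eq0// => i _.
  by have := h i; rewrite negbK => /eqP ->; rewrite expr0n.
by move/sigW.
Qed.

(** Blocks of one Schmidt vector, each sent to slot 0. This shows that the supremum defining the
    fidelity runs over a nonempty set, and for dimension 1 it gives fidelity 1. *)
Let trivial_protocol k : exists2 L : superop R (A * B) ('I_k.+1 * 'I_k.+1), in_class Omega L &
    real_complex R (k.+1%:R^-1 * \sum_x (\sum_(i | i == x) s i) ^+ 2) <=
    overlap (L (outer psi psi)).
Proof.
have [i0 _] := schmidt_index.
apply: (block_protocol sch (g := id) (pos := fun=> ord0)) => //.
by move=> i j [].
Qed.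

Lemma fidelity_le k r :
  (forall L : superop R (A * B) ('I_k.+1 * 'I_k.+1), in_class Omega L ->
    overlap (L (outer psi psi)) <= real_complex R r) ->
  fidelity Omega (outer psi psi) k.+1 <= r.
Proof.
move=> h; apply: ge_sup.
  have [L hL _] := trivial_protocol k.
  by exists (complex.Re (\tr (L (outer psi psi) *m max_entangled R k.+1))), L.
move=> _ [L hL <-]; rewrite tr_max_entangled.
by have := h L hL; rewrite lecE => /andP[].
Qed.

Lemma fidelity_ge k r (L : superop R (A * B) ('I_k.+1 * 'I_k.+1)) : in_class Omega L ->
  real_complex R r <= overlap (L (outer psi psi)) -> r <= fidelity Omega (outer psi psi) k.+1.
Proof.
move=> hL; rewrite lecE /= => /andP[_ h]; apply: (le_trans h).
rewrite -tr_max_entangled; apply: ub_le_sup; last by exists L.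
exists (complex.Re (\tr (outer psi psi))) => _ [L' /in_class_ppt_positive pL' <-].
have [_ posL' _ trL'] := pL'.
by rewrite tr_max_entangled -trL'; have := overlap_le_tr (posL' _ (psd_outer psi)); rewrite lecE => /andP[].
Qed.

Lemma fidelity_converse k t c : 0 < t -> 0 < c ->
  fidelity Omega (outer psi psi) k.+1 <=
  (1 + c) * (\sum_(i | s i ^+ 2 < t) s i ^+ 2) + (1 + c^-1) / (k.+1%:R * t).
Proof.
move=> t0 c0; apply: fidelity_le => L /in_class_ppt_positive pL.
exact: (overlap_converse sch _ pL).
Qed.

Lemma fidelity_achievable (T : finType) (cl : I -> T) (q : T -> R) k t :
  (forall x, 0 <= q x) -> (forall i, s i ^+ 2 = q (cl i)) -> 0 <= t ->
  1 - \sum_(i | t < s i ^+ 2) s i ^+ 2 - #|T|%:R * (k.+1%:R * t) <=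
  fidelity Omega (outer psi psi) k.+1.
Proof.
move=> q0 sq t0; have [i0 _] := schmidt_index.
have [L hL h] := block_protocol sch (@block_slot_inj _ _ cl k) Omega (block cl k i0).
apply: (fidelity_ge hL); apply: le_trans h; rewrite lecR.
by apply: block_sum_ge; [exact: (schmidt_ge0 sch)| | |exact: (schmidt_norm sch)| ].
Qed.

Lemma fidelity1 : 1 <= fidelity Omega (outer psi psi) 1.
Proof.
have [L hL h] := trivial_protocol 0; apply: (fidelity_ge hL); apply: le_trans h.
rewrite lecR invr1 mul1r -(schmidt_norm sch); apply: ler_sum => i _.
by rewrite big_pred1_eq.
Qed.

End Fidelity.

Section Log2.
Implicit Types x y : R.

Lemma ln2_gt0 : 0 < ln (2 : R).
Proof. by apply: ln_gt0; rewrite ltr1n. Qed.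

Lemma log2M x y : 0 < x -> 0 < y -> log2 (x * y) = log2 x + log2 y.
Proof. by move=> x0 y0; rewrite /log2 lnM// mulrDl. Qed.

Lemma log2V x : 0 < x -> log2 x^-1 = - log2 x.
Proof. by move=> x0; rewrite /log2 lnV// mulNr. Qed.

Lemma log2_le x y : 0 < x -> x <= y -> log2 x <= log2 y.
Proof.
move=> x0 xy; rewrite /log2 ler_wpM2r ?invr_ge0 ?(ltW ln2_gt0)//.
by rewrite ler_ln// posrE// (lt_le_trans x0).
Qed.

Lemma log2_2 : log2 (2 : R) = 1.
Proof. by rewrite /log2 divff// gt_eqF// ln2_gt0. Qed.

Lemma log2_1 : log2 (1 : R) = 0.
Proof. by rewrite /log2 ln1 mul0r. Qed.

Definition exp2 x : R := expR (x * ln 2).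

Lemma exp2_gt0 x : 0 < exp2 x. Proof. exact: expR_gt0. Qed.

Lemma log2_exp2 x : log2 (exp2 x) = x.
Proof. by rewrite /log2 /exp2 expRK mulfK// gt_eqF// ln2_gt0. Qed.

Lemma exp2_log2 x : 0 < x -> exp2 (log2 x) = x.
Proof. by move=> x0; rewrite /exp2 /log2 divfK ?lnK// gt_eqF// ln2_gt0. Qed.

Lemma ltr_exp2 x y : (exp2 x < exp2 y) = (x < y).
Proof. by rewrite /exp2 ltr_expR ltr_pM2r// ln2_gt0. Qed.

Lemma log2_prod (n : nat) (F : 'I_n -> R) : (forall k, 0 < F k) ->
  log2 (\prod_k F k) = \sum_k log2 (F k).
Proof.
move=> F0; elim: n F F0 => [|n IH] F F0; first by rewrite !big_ord0 log2_1.
rewrite !big_ord_recl log2M ?prodr_gt0// IH// => k; exact: F0.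
Qed.

Lemma log2X x n : 0 < x -> log2 (x ^+ n) = n%:R * log2 x.
Proof.
move=> x0; elim: n => [|n IH]; first by rewrite expr0 log2_1 mul0r.
by rewrite exprS log2M ?exprn_gt0// IH mulrSr; ring.
Qed.

End Log2.

(** * Tails of the product distribution in terms of the sum of logarithms *)

Section Tails.
Variables (K : finType) (p : K -> R) (n : nat).
Hypotheses (p0 : forall x, 0 <= p x) (p1 : \sum_x p x = 1).
Local Notation X := (fun x => - log2 (p x)).
Local Notation w i := (\prod_k p (i k)).

(** Fails at weight 0, where [log2 0 = 0] makes the right side positive; such sequences contribute
    nothing to the tails. *)
Lemma prod_exp2 (i : {ffun 'I_n -> K}) : w i != 0 -> w i = exp2 (- \sum_k X (i k)).
Proof.
move=> wi; have pk k : 0 < p (i k).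
  by rewrite lt_def p0 andbT; move/prodf_neq0: wi; apply.
rewrite sumrN opprK -log2_prod// exp2_log2//.
by rewrite lt_def wi prodr_ge0.
Qed.

Lemma lower_tail l : \sum_(i : {ffun 'I_n -> K} | w i < exp2 (- l)) w i <= 1 - sum_cdf p X n l.
Proof.
rewrite -[Z in _ <= Z - _](sum_prod_ffun p1 n) /sum_cdf -sumrB big_mkcond; apply: ler_sum => i _.
have [w0|w0] := eqVneq (w i) 0.
  by rewrite w0 mul0r subr0; case: ifP.
rewrite {1}(prod_exp2 w0) ltr_exp2 ltrN2 ltNge.
by case: (_ <= l) => /=; rewrite ?mulr1n ?mulr0n ?mulr1 ?mulr0 ?subrr ?subr0.
Qed.

Lemma upper_tail l : \sum_(i : {ffun 'I_n -> K} | exp2 (- l) < w i) w i <= sum_cdf p X n l.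
Proof.
rewrite big_mkcond; apply: ler_sum => i _.
have [w0|w0] := eqVneq (w i) 0.
  by rewrite w0 mul0r; case: ifP.
have wge : 0 <= w i by apply: prodr_ge0.
rewrite {1}(prod_exp2 w0) ltr_exp2 ltrN2; case: ltP => [/ltW ->|_]; first by rewrite mulr1.
by rewrite mulr_ge0.
Qed.

End Tails.

(** From n + 1 <= n^2. It absorbs constants and the number of types into multiples of log n. *)
Lemma log2_nat_succ (n : nat) : (2 <= n)%N ->
  1 <= log2 n%:R :> R /\ log2 n.+1%:R <= 2 * log2 n%:R :> R.
Proof.
move=> n2; have n0 : 0 < n%:R :> R by rewrite ltr0n (leq_trans _ n2).
split; first by rewrite -[leLHS]log2_2 log2_le// ler_nat.
rewrite -log2X//; apply: log2_le; first by rewrite ltr0n.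
rewrite -natrX ler_nat; case: n n2 {n0} => [//|[//|n]] _.
by rewrite expnS expn1 mulSn -[n.+3]addn1 leq_add2l muln_gt0.
Qed.

(** * Admissible dimensions and the choice of the threshold *)

Section Main.
Variables (A B : finType) (psi : A * B -> C) (eps : R) (Omega : op_class).
Hypothesis psi1 : \sum_p (psi p)^* * psi p = 1.
Hypotheses (eps_gt0 : 0 < eps) (eps_lt1 : eps < 1).

Local Notation p := (eigenprob psi).
Local Notation X := (fun t => - log2 (p t)).

Definition second_order_value (n : nat) : R :=
  n%:R * mean p X + Num.sqrt (n%:R * variance p X) * Phi_inv eps.

Definition admissible (n : nat) : set nat :=
  [set k | (1 <= k)%N /\ 1 - eps <= fidelity Omega (outer (ket_tpow n psi) (ket_tpow n psi)) k].

Local Notation l := second_order_value.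

Let p0 t : 0 <= p t. Proof. exact: eigenprob_ge0. Qed.
Let p1 : \sum_t p t = 1. Proof. exact: eigenprob_sum. Qed.
Let sch n := schmidt_tpow n (schmidt_exists psi1).

Let sE n (i : {ffun 'I_n -> 'I_#|A|}) : (\prod_k Num.sqrt (p (i k))) ^+ 2 = \prod_k p (i k).
Proof. by rewrite -prodrXl; apply: eq_bigr => k _; rewrite sqr_sqrtr. Qed.

(** Take t = 2^-(l + D) and c = r = 1/sqrt n in the converse. If kt >= n, the second term is at most
    r^2 + r <= 2r and the factor 1 + r costs at most r, so of the margin 4r one r remains and makes
    the fidelity strictly less than 1 - eps. *)
Lemma admissible_lt n D k : (0 < n)%N ->
  eps + 4 / Num.sqrt n%:R <= sum_cdf p X n (l n + D) ->
  admissible n k -> k%:R * exp2 (- (l n + D)) < n%:R.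
Proof.
have e0 := eps_gt0; move=> n0 hD [k0 hk]; rewrite ltNge; apply/negP => ht.
case: k k0 hk ht => [//|k] _ hk ht.
have s0 : 0 < Num.sqrt n%:R :> R by rewrite sqrtr_gt0 ltr0n.
pose r : R := (Num.sqrt n%:R)^-1; have r0 : 0 < r by rewrite invr_gt0.
have key (Y c F : R) : Y <= 1 - c -> eps + 4 * r <= c -> F <= 2 * r ->
    (1 + r) * Y + F < 1 - eps.
  move=> hY hc hF; have Y1 : Y <= 1 by lra.
  by have := ler_wpM2l (ltW r0) Y1; rewrite mulr1 mulrDl mul1r; lra.
have := fidelity_converse Omega (sch n) k (exp2_gt0 (- (l n + D))) r0.
apply/negP; rewrite -ltNge; apply: lt_le_trans hk.
rewrite (eq_big (fun i : {ffun 'I_n -> 'I_#|A|} => \prod_k p (i k) < exp2 (- (l n + D)))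
  (fun i => \prod_k p (i k))) => [|i|i _]; rewrite ?sE//.
have h1 := @lower_tail _ p n p0 p1 (l n + D).
have r1 : r <= 1.
  by rewrite invf_le1// -[leLHS]sqrtr1 ler_wsqrtr// ler1n.
have rr : n%:R = r ^- 2.
  by rewrite /r exprVn invrK sqr_sqrtr.
have h2 : (1 + r^-1) / (k.+1%:R * exp2 (- (l n + D))) <= 2 * r.
  apply: le_trans (_ : (1 + r^-1) / n%:R <= _).
    rewrite ler_wpM2l ?addr_ge0 ?invr_ge0 ?(ltW r0)//.
    by rewrite lef_pV2// posrE ?ltr0n// mulr_gt0// exp2_gt0.
  have -> : (1 + r^-1) / n%:R = r * r + r.
    by rewrite rr; field; rewrite gt_eqF.
  by have := ler_wpM2l (ltW r0) r1; lra.
apply: key h1 _ h2; rewrite -/r in hD; exact: hD.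
Qed.

Lemma admissible1 n : admissible n 1.
Proof.
have e0 := eps_gt0; split => //; apply: le_trans (fidelity1 Omega (sch n)); lra.
Qed.

Lemma admissible_ge n D (k : nat) :
  sum_cdf p X n (l n - D) <= eps - (Num.sqrt n%:R)^-1 ->
  (n.+1 ^ #|A|)%:R * (k.+1%:R * exp2 (- (l n - D))) <= (Num.sqrt n%:R)^-1 ->
  admissible n k.+1.
Proof.
move=> hD hk; split => //.
have q0 (x : {ffun 'I_#|A| -> 'I_n.+1}) : 0 <= \prod_t p t ^+ x t.
  by apply: prodr_ge0 => t _; rewrite exprn_ge0.
have sq (i : {ffun 'I_n -> 'I_#|A|}) : (\prod_k Num.sqrt (p (i k))) ^+ 2 =
    \prod_t p t ^+ type_class i t by rewrite sE prod_type_class.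
apply: le_trans (fidelity_achievable Omega (sch n) k q0 sq (ltW (exp2_gt0 (- (l n - D))))).
rewrite card_type_class card_ord.
rewrite (eq_big (fun i : {ffun 'I_n -> 'I_#|A|} => exp2 (- (l n - D)) < \prod_k p (i k))
  (fun i => \prod_k p (i k))) => [|i|i _]; rewrite ?sE//.
have := @upper_tail _ p n p0 (l n - D); lra.
Qed.

Lemma log2_sqrt n : (0 < n)%N -> log2 (Num.sqrt n%:R) = 2^-1 * log2 n%:R :> R.
Proof.
move=> n0; have s0 : 0 < Num.sqrt n%:R :> R by rewrite sqrtr_gt0 ltr0n.
have : log2 n%:R = log2 (Num.sqrt n%:R) + log2 (Num.sqrt n%:R) :> R.
  by rewrite -log2M// -expr2 sqr_sqrtr.
by move=> ->; field.
Qed.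

Lemma second_order_distillation : exists M : R, \forall n \near \oo,
  `|log2 (max_nat (admissible n))%:R - l n| <= M * log2 n%:R.
Proof.
have [D hD] := @second_order_quantile R _ p X p0 p1 eps eps_gt0 eps_lt1.
(* [2 * #|A|] covers the number of types, through log(n + 1) <= 2 log n; the last 2 covers the half
   logarithm of the margin 1/sqrt n and one bit of rounding. *)
exists (`|D| + 2 * #|A|%:R + 2); near=> n.
have [hD1 hD2] : eps + 4 / Num.sqrt n%:R <= sum_cdf p X n (l n + D) /\
    sum_cdf p X n (l n - D) <= eps - (Num.sqrt n%:R)^-1 by near: n; exact: hD.
have n2 : (2 <= n)%N by near: n; exact: nbhs_infty_ge.
have n0 : (0 < n)%N by rewrite (leq_trans _ n2).
have n0' : 0 < n%:R :> R by rewrite ltr0n.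
have [log1 logS] := log2_nat_succ n2.
have bnd k := admissible_lt (k := k) n0 hD1.
have e0 := exp2_gt0 (- (l n + D)).
have [|Sm max_m] := @max_natP (admissible n) (Num.bound (n%:R / exp2 (- (l n + D)))) (admissible1 n).
  move=> k /bnd; rewrite -ltr_pdivlMr// => hk.
  rewrite -(ler_nat R) ltW// (lt_trans hk)// archi_boundP// divr_ge0//.
  exact: ltW.
set m := max_nat _ in Sm max_m *.
have m1 : (1 <= m)%N by have [] := Sm.
have m0 : 0 < m%:R :> R by rewrite ltr0n.
have upper : log2 m%:R <= log2 n%:R + (l n + D).
  have := ltW (bnd _ Sm) => /log2_le; rewrite mulr_gt0// => /(_ isT).
  by rewrite log2M// log2_exp2; lra.
have s0 : 0 < Num.sqrt n%:R :> R by rewrite sqrtr_gt0.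
pose N : R := (n.+1 ^ #|A|)%:R.
have N0 : 0 < N by rewrite ltr0n expn_gt0.
pose t := exp2 (- (l n - D)); have t0 : 0 < t by exact: exp2_gt0.
(* The largest real dimension for which the loss N Y t from incomplete blocks is within the margin
   1/sqrt n. *)
pose Y : R := (Num.sqrt n%:R)^-1 * (N * t)^-1.
have Y0 : 0 < Y by rewrite mulr_gt0 ?invr_gt0 ?mulr_gt0.
have logY : log2 Y = l n - D - 2^-1 * log2 n%:R - #|A|%:R * log2 n.+1%:R.
  rewrite log2M ?invr_gt0 ?mulr_gt0// !log2V ?mulr_gt0// log2M// log2_sqrt//.
  by rewrite log2_exp2 /N natrX log2X//; ring.
(* The integer part of Y is admissible and at least Y/2 when Y >= 1; when Y < 1 its logarithm is
   negative and dimension 1 suffices. *)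
have lower : log2 Y - 1 <= log2 m%:R.
  have logm0 : 0 <= log2 m%:R :> R by rewrite -[leLHS]log2_1 log2_le// ler1n.
  have [Y1|Y1] := ltP Y 1.
    have : log2 Y <= 0 by rewrite -[leRHS]log2_1 log2_le// ltW.
    by lra.
  have /andP[kY Yk] := truncn_itv (ltW Y0).
  have k1 : (0 < Num.truncn Y)%N by rewrite truncn_gt0.
  case: (Num.truncn Y) k1 kY Yk => [//|k] _ kY Yk.
  have Sk : admissible n k.+1.
    apply: (admissible_ge hD2); rewrite -/t -/N mulrCA -ler_pdivlMr ?mulr_gt0//.
  have := max_m _ Sk; rewrite -(ler_nat R) => km.
  have : log2 (Y / 2) <= log2 m%:R.
    apply: log2_le; first by rewrite divr_gt0.
    apply: le_trans km; rewrite ler_pdivrMr//; apply: (le_trans (ltW Yk)).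
    by rewrite -natrM ler_nat muln2 -addnn addSn !ltnS leq_addl.
  by rewrite log2M ?invr_gt0// log2V// log2_2.
have hd : #|A|%:R * log2 n.+1%:R <= 2 * #|A|%:R * log2 n%:R :> R.
  by rewrite -[leRHS]mulrA [leRHS]mulrCA ler_wpM2l.
have hDn : `|D| <= `|D| * log2 n%:R by rewrite ler_peMr.
have := ler_norm D; have := ler_norm (- D); rewrite normrN => h1 h2.
have A0 : 0 <= 2 * #|A|%:R :> R by rewrite mulr_ge0.
have := mulr_ge0 A0 (le_trans ler01 log1) => AL0.
rewrite !mulrDl ler_norml; apply/andP; split; lra.
Unshelve. all: by end_near. Qed.

End Main.
End Assembly.

Unset Implicit Arguments.

Theorem proposition8 (R : realType) (A B : finType) (psi : ket R (A * B))
    (psi_unit : psi^t* *m psi = 1%:M)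
    (eps : R) (eps_gt0 : 0 < eps) (eps_lt1 : eps < 1) (Omega : op_class) :
  let psiAB : op R (A * B) := psi *m psi^t* in
  let rhoA : op R A := ptrace2 psiAB in
  (fun n : nat =>
     distillable_entanglement Omega eps (bipartite_tpow n psiAB)) =
  (fun n : nat =>
     n%:R * entropy rhoA
     + Num.sqrt (n%:R * entropy_variance rhoA) * Phi_inv eps)
  +O_\oo (fun n : nat => log2 (n%:R : R)).
Proof.
move=> psiAB rhoA.
pose ampl (p : A * B) := psi (enum_rank p) 0.
have psiABE : psiAB = outer ampl ampl.
  apply: opP => p q; rewrite entry_opmx /entry /psiAB mxE big_ord1 !mxE; exact: erefl.
have ampl1 : \sum_p (ampl p)^* * ampl p = 1.
  have := congr1 (fun M : 'M[complex R]_1 => M 0 0) psi_unit; rewrite !mxE sum_enum_rank mulr1n => <-.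
  by apply: eq_bigr => p _; rewrite !mxE.
have [M hM] := @second_order_distillation R A B ampl eps Omega ampl1 eps_gt0 eps_lt1.
(* Here [k] is the constant implied by O, to be taken at least [M]; for n >= 1 the norm of log n is
   log n itself. *)
apply/eqaddOP; near=> k; near=> n.
have hn : `|log2 (max_nat (admissible ampl eps Omega n))%:R - second_order_value ampl eps n| <=
    M * log2 n%:R by near: n; exact: hM.
rewrite /rhoA psiABE (entropy_mean ampl) (entropy_variance_variance ampl).
rewrite (_ : (fun n => distillable_entanglement _ _ _) =
    (fun n => log2 (max_nat (admissible ampl eps Omega n))%:R)); last first.
  by apply/funext => j; rewrite /distillable_entanglement bipartite_tpow_outer.
apply: (le_trans hn).
have n1 : (1 <= n)%N by near: n; exact: nbhs_infty_ge.
have log0 : 0 <= log2 n%:R :> R by rewrite -[leLHS](log2_1 R) log2_le// ler1n.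
rewrite [leRHS](_ : _ = k * log2 n%:R); last by rewrite ger0_norm.
by rewrite ler_wpM2r//; near: k; apply: nbhs_pinfty_ge; exact: num_real.
Unshelve. all: by end_near. Qed.
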